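(* Let $k$ be a perfect field of prime characteristic, and let $(A,\mathfrak{m})$ be a regular local ring that is essentially of finite type over $k$ with fraction field $K$. Let $\nu$ be a nontrivial, real-valued Abhyankar valuation of $K/k$ centered on $(A,\mathfrak{m})$, and let $\mathfrak{a}_\bullet = \{\mathfrak{a}_m(A)\}_{m\in\mathbb{R}_{\ge 0}}$ be the graded family of valuation ideals $\mathfrak{a}_m(A) = \{a\in A: \nu(a)\ge m\}$ of $A$. Then there exists $r\in A-\{0\}$ such that for all $m\in\mathbb{R}_{\ge 0}$, $$r\cdot\tau_m(A,\mathfrak{a}_\bullet)\subseteq\mathfrak{a}_m(A),$$ where $\tau_m(A,\mathfrak{a}_\bullet)$ is the $m$-th asymptotic test ideal of $\mathfrak{a}_\bullet$. In other words, $\bigcap_{m\in\mathbb{R}_{\ge 0}}(\mathfrak{a}_m(A):\tau_m(A,\mathfrak{a}_\bullet))\neq(0)$.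
   Context: $\mathbb{N} = \{1,2,3,\dots\}$. A ring is essentially of finite type over $k$ if it is a localization of a finitely generated $k$-algebra at some multiplicative set. A valuation $\nu$ of a finitely generated field extension $K/k$ with value group $\Gamma_\nu$ (a totally ordered abelian group, written additively) is a surjective group homomorphism $\nu: K^\times \to \Gamma_\nu$ with $\nu(k^\times)=\{0\}$ and $\nu(x+y)\ge \min\{\nu(x),\nu(y)\}$ whenever $x,y,x+y \neq 0$ (convention: $\nu(0)=\infty$). Its valuation ring is $R_\nu=\{x\in K^\times:\nu(x)\ge 0\}\cup\{0\}$, a local ring with maximal ideal $\mathfrak{m}_\nu$ and residue field $\kappa_\nu$. It is real-valued if $\Gamma_\nu$ is an ordered subgroup of $\mathbb{R}$. It is an Abhyankar valuation if $\dim_{\mathbb{Q}}(\mathbb{Q}\otimes_{\mathbb{Z}}\Gamma_\nu) + \operatorname{tr.deg}(\kappa_\nu/k) = \operatorname{tr.deg}(K/k)$. It is centered on $(A,\mathfrak{m})$ if $A\subseteq R_\nu$ and $\mathfrak{m}=\mathfrak{m}_\nu\cap A$. Test ideals. For a ring $R$ of characteristic $p>0$, $F^e_*R$ denotes $R$ viewed as an $R$-module via the $e$-th iterate of Frobenius $F^e: R\to R$, $r\mapsto r^{p^e}$; $R$ is F-finite if $F_*R$ is a finitely generated $R$-module (rings essentially of finite type over a perfect field are F-finite). For an F-finite Noetherian domain $R$, a nonzero ideal $\mathfrak{a}\subseteq R$ and a real number $t>0$, the test ideal $\tau(R,\mathfrak{a}^t)$ (also written $\tau(\mathfrak{a}^t)$)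 is the smallest nonzero ideal $J$ of $R$ such that for all $e\in\mathbb{N}$ and all $\phi\in\operatorname{Hom}_R(F^e_*R,R)$, $\phi(F^e_*(J\mathfrak{a}^{\lceil t(p^e-1)\rceil}))\subseteq J$ (such a smallest ideal is known to exist). Asymptotic test ideals. A graded family of ideals of $R$ indexed by an additive sub-semigroup $\Phi\subseteq\mathbb{R}$ is a family of nonzero ideals $\mathfrak{a}_\bullet=\{\mathfrak{a}_s\}_{s\in\Phi}$ with $\mathfrak{a}_s\mathfrak{a}_t\subseteq\mathfrak{a}_{s+t}$ for all $s,t\in\Phi$. For $m\in\Phi$, the $m$-th asymptotic test ideal is $\tau_m(R,\mathfrak{a}_\bullet)=\sum_{\ell\in\mathbb{N}}\tau(R,\mathfrak{a}_{\ell m}^{1/\ell})$. *)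

(* Defs.v *)
From HB Require Import structures.
From mathcomp Require Import all_boot all_order all_algebra.
From mathcomp Require Import all_classical all_reals.
From mathcomp Require Import -(notations) mpoly.

Set Implicit Arguments.
Unset Strict Implicit.
Unset Printing Implicit Defensive.

Import Order.TTheory GRing.Theory Num.Theory.

Local Open Scope classical_set_scope.
Local Open Scope ring_scope.

Section Ideals.
Context (A : comNzRingType).
Implicit Types (I J S m : set A).

Definition is_ideal I : Prop :=
  [/\ I 0, forall x y, I x -> I y -> I (x + y) & forall a x, I x -> I (a * x)].

Definition ideal_gen S : set A := smallest is_ideal S.

Definition ideal_mul I J : set A := ideal_gen [set x * y | x in I & y in J].

Definition ideal_exp I (n : nat) : set A := iter n (ideal_mul I) setT.

Definition ideal_colon I J : set A := [set a | forall b, J b -> I (a * b)].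

Definition generated_by I (d : nat) : Prop :=
  exists x : 'I_d -> A, I = ideal_gen (range x).

Definition noetherian : Prop :=
  forall I, is_ideal I -> exists d, generated_by I d.

Definition prime_ideal I : Prop :=
  [/\ is_ideal I, ~ I 1 & forall x y, I (x * y) -> I x \/ I y].

Definition maximal_ideal I : Prop :=
  [/\ is_ideal I, ~ I 1 &
      forall J, is_ideal J -> ~ J 1 -> I `<=` J -> J = I].

Definition local_ring m : Prop :=
  maximal_ideal m /\ forall m', maximal_ideal m' -> m' = m.

Definition prime_chain (d : nat) : Prop :=
  exists P : nat -> set A,
    (forall i, (i <= d)%N -> prime_ideal (P i)) /\
    (forall i, (i < d)%N -> P i `<` P i.+1).

Definition krull_dim (d : nat) : Prop :=
  prime_chain d /\ forall d', prime_chain d' -> (d' <= d)%N.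

Definition min_generators I (d : nat) : Prop :=
  generated_by I d /\ forall d', generated_by I d' -> (d <= d')%N.

Definition regular_local_ring m : Prop :=
  [/\ noetherian, local_ring m & exists d, krull_dim d /\ min_generators m d].

End Ideals.

Arguments noetherian : clear implicits.
Arguments krull_dim : clear implicits.

(* [f] is the structure map of a [k]-algebra [B]. *)
Definition finitely_generated_algebra (k : fieldType) (B : comNzRingType)
    (f : {rmorphism k -> B}) : Prop :=
  exists (n : nat) (x : 'I_n -> B),
    forall b, exists P : mpoly n k, mmap f x P = b.

Definition multiplicative_set (B : comNzRingType) (S : set B) : Prop :=
  S 1 /\ forall s t, S s -> S t -> S (s * t).

(* [g] exhibits [A] as the localization of [B] at [S]. *)
Definition is_localization (B : comNzRingType) (S : set B)
    (A : comUnitRingType) (g : {rmorphism B -> A}) : Prop :=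
  [/\ forall s, S s -> g s \is a GRing.unit,
      forall a, exists b s, S s /\ a = g b / g s &
      forall b, g b = 0 -> exists2 s, S s & s * b = 0].

Definition essentially_of_finite_type (k : fieldType) (A : comUnitRingType)
    (f : {rmorphism k -> A}) : Prop :=
  exists (B : comNzRingType) (h : {rmorphism k -> B}) (S : set B)
         (g : {rmorphism B -> A}),
    [/\ finitely_generated_algebra h, multiplicative_set S,
        is_localization S g & forall c, g (h c) = f c].

Definition perfect_field (k : fieldType) (p : nat) (charkp : p \in [pchar k]) :
    Prop :=
  forall x : k, exists y : k, pFrobenius_aut charkp y = x.

Definition alg_independent (k L : fieldType) (f : {rmorphism k -> L})
    (n : nat) (x : 'I_n -> L) : Prop :=
  forall P : mpoly n k, mmap f x P = 0 -> P = 0.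

Definition trdeg (k L : fieldType) (f : {rmorphism k -> L}) (d : nat) : Prop :=
  (exists x : 'I_d -> L, alg_independent f x) /\
  forall n (x : 'I_n -> L), alg_independent f x -> (n <= d)%N.

(* The universal property of [G -> Q (x)_Z G], x |-> 1 (x) x, among additive
   maps from [G] to rational vector spaces. *)
Definition is_rational_extension (G : zmodType) (V : lmodType rat)
    (i : {additive G -> V}) : Prop :=
  forall (W : lmodType rat) (g : {additive G -> W}),
    exists h : {linear V -> W}, (forall x, h (i x) = g x) /\
      forall h' : {linear V -> W}, (forall x, h' (i x) = g x) -> h' =1 h.

(* dim_Q (Q (x)_Z G) = r *)
Definition rational_rank (G : zmodType) (r : nat) : Prop :=
  exists (V : vectType rat) (i : {additive G -> V}),
    is_rational_extension i /\ (\dim {:V} = r)%VS.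

(* Real-valued valuations of K/k; the value of [valuation_fun] at 0 is
   irrelevant, and [value] below implements the convention nu(0) = +oo. *)
Record valuation (R : realType) (k K : fieldType) (j : {rmorphism k -> K}) :=
  Valuation {
    valuation_fun : K -> R;
    valuation_const : forall c, c != 0 -> valuation_fun (j c) = 0;
    valuationM : forall x y, x != 0 -> y != 0 ->
      valuation_fun (x * y) = valuation_fun x + valuation_fun y;
    valuationD : forall x y, x != 0 -> y != 0 -> x + y != 0 ->
      Num.min (valuation_fun x) (valuation_fun y) <= valuation_fun (x + y) }.

Section Valuation.
Context (R : realType) (k K : fieldType) (j : {rmorphism k -> K}).
Context (nu : valuation R j).

Definition value (x : K) : \bar R :=
  if x == 0 then +oo%E else (valuation_fun nu x)%:E.

Definition nontrivial_valuation : Prop :=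
  exists2 x, x != 0 & valuation_fun nu x <> 0.

Lemma valuation1 : valuation_fun nu 1 = 0.
Proof. by have := valuation_const nu (oner_neq0 k); rewrite rmorph1. Qed.

Lemma valuationV x : x != 0 -> valuation_fun nu x^-1 = - valuation_fun nu x.
Proof.
move=> x0; apply/eqP; rewrite -addr_eq0 addrC -(valuationM nu) ?invr_eq0//.
by rewrite divff// valuation1.
Qed.

Lemma valuationN x : x != 0 -> valuation_fun nu (- x) = valuation_fun nu x.
Proof.
move=> x0; have N1 : (-1 : k) != 0 by rewrite oppr_eq0 oner_neq0.
have := valuation_const nu N1; rewrite rmorphN1 => v1.
by rewrite -mulN1r (valuationM nu) ?oppr_eq0 ?oner_neq0// v1 add0r.
Qed.

Lemma valueM x y : value (x * y) = (value x + value y)%E.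
Proof.
rewrite /value mulf_eq0; case: eqVneq => x0 /=; first by case: eqVneq.
by case: eqVneq => y0 //=; rewrite (valuationM nu)// EFinD.
Qed.

Lemma valueN x : value (- x) = value x.
Proof. by rewrite /value oppr_eq0; case: eqVneq => // x0; rewrite valuationN. Qed.

Lemma valueD x y : (Order.min (value x) (value y) <= value (x + y))%E.
Proof.
rewrite /value; case: (eqVneq x 0) => [->|x0].
  by rewrite add0r minye.
case: (eqVneq y 0) => [->|y0]; first by rewrite addr0 (negbTE x0) miney.
case: ifPn => [_|xy0]; first by rewrite leey.
by rewrite -EFin_min lee_fin valuationD.
Qed.

Definition value_group_pred : {pred R} :=
  fun g => `[< exists2 x, x != 0 & valuation_fun nu x = g >].

Fact value_group_zmod : zmod_closed value_group_pred.
Proof.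
split=> [|g h].
  by apply/asboolP; exists 1; rewrite ?oner_neq0 ?valuation1.
move=> /asboolP[x x0 <-] /asboolP[y y0 <-]; apply/asboolP.
exists (x / y); first by rewrite mulf_neq0 ?invr_eq0.
by rewrite (valuationM nu) ?invr_eq0// valuationV.
Qed.

HB.instance Definition _ :=
  GRing.isZmodClosed.Build R value_group_pred value_group_zmod.

Record value_group :=
  ValueGroup { value_group_val : R; _ : value_group_val \in value_group_pred }.

HB.instance Definition _ := [isSub for value_group_val].
HB.instance Definition _ := [Choice of value_group by <:].
HB.instance Definition _ := [SubChoice_isSubZmodule of value_group by <:].

Definition valuation_ring_pred : {pred K} := fun x => (0%:E <= value x)%E.

Fact valuation_ring_subring : subring_closed valuation_ring_pred.
Proof.
split=> [|x y|x y]; rewrite -!topredE /= /valuation_ring_pred.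
- by rewrite /value oner_eq0 valuation1.
- move=> x0 y0; apply: le_trans (valueD x (- y)).
  by rewrite valueN le_min x0 y0.
- by move=> x0 y0; rewrite valueM adde_ge0.
Qed.

HB.instance Definition _ :=
  GRing.isSubringClosed.Build K valuation_ring_pred valuation_ring_subring.

Record valuation_ring := ValuationRing {
  valuation_ring_val : K; _ : valuation_ring_val \in valuation_ring_pred }.

HB.instance Definition _ := [isSub for valuation_ring_val].
HB.instance Definition _ := [Choice of valuation_ring by <:].
HB.instance Definition _ := [SubChoice_isSubComNzRing of valuation_ring by <:].

Definition valuation_max_ideal : {pred valuation_ring} :=
  fun x => (0%:E < value (val x))%E.

Fact valuation_max_ideal_closed : idealr_closed valuation_max_ideal.
Proof.
split=> [||a x y]; rewrite -!topredE /= /valuation_max_ideal.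
- by rewrite /value /= eqxx ltry.
- by rewrite /value /= oner_eq0 valuation1 ltxx.
- move=> x0 y0; apply: lt_le_trans (valueD _ _).
  rewrite lt_min y0 andbT valueM; apply: lt_le_trans x0 _.
  exact: leeDr (valP a).
Qed.

HB.instance Definition _ :=
  isIdealr.Build valuation_ring valuation_max_ideal valuation_max_ideal_closed.

Definition residue_field : Type := {ideal_quot valuation_max_ideal}.

HB.instance Definition _ := GRing.ComNzRing.on residue_field.

Definition residue : {rmorphism valuation_ring -> residue_field} :=
  \pi_residue_field%qT.

Definition residue_inv (x : residue_field) : residue_field :=
  if x == 0 then 0 else residue (insubd 0 (val (repr x))^-1).

Fact residue_mulVf x : x != 0 -> residue_inv x * x = 1.
Proof.
rewrite /residue_inv => x0; rewrite (negbTE x0).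
have rx : residue (repr x) = x by rewrite /residue /= reprK.
have rm : repr x \notin valuation_max_ideal.
  apply: contra x0 => xm; rewrite -rx -(rmorph0 residue).
  by rewrite /residue /= -Quotient.idealrBE subr0.
have r0 : val (repr x) != 0.
  apply: contra rm => /eqP r0.
  by rewrite -topredE /= /valuation_max_ideal r0 /value eqxx ltry.
have vr : valuation_fun nu (val (repr x)) = 0.
  have := valP (repr x); move: rm.
  rewrite -!topredE /= /valuation_max_ideal /valuation_ring_pred /value.
  rewrite (negbTE r0) lte_fin lee_fin -leNgt => h1 h2.
  by apply/eqP; rewrite eq_le h1 h2.
have rV : (val (repr x))^-1 \in valuation_ring_pred.
  rewrite -topredE /= /valuation_ring_pred /value invr_eq0 (negbTE r0).
  by rewrite valuationV// vr oppr0.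
rewrite -{2}rx -rmorphM -(rmorph1 residue); congr (residue _).
by apply: val_inj; rewrite /= insubdK// mulVf.
Qed.

Fact residue_inv0 : residue_inv 0 = 0.
Proof. by rewrite /residue_inv eqxx. Qed.

HB.instance Definition _ :=
  GRing.ComNzRing_isField.Build residue_field residue_mulVf residue_inv0.

Fact valuation_ring_const c : j c \in valuation_ring_pred.
Proof.
rewrite -topredE /= /valuation_ring_pred /value fmorph_eq0.
by case: eqVneq => [_|c0]; rewrite ?leey// (valuation_const nu c0).
Qed.

Definition const_valuation_ring (c : k) : valuation_ring :=
  ValuationRing (valuation_ring_const c).

Fact const_valuation_ring_zmod : zmod_morphism const_valuation_ring.
Proof. by move=> x y; apply: val_inj; rewrite /= rmorphB. Qed.

Fact const_valuation_ring_monoid : monoid_morphism const_valuation_ring.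
Proof.
by split=> [|x y]; apply: val_inj; rewrite /= ?rmorph1 ?rmorphM.
Qed.

HB.instance Definition _ := GRing.isZmodMorphism.Build k valuation_ring
  const_valuation_ring const_valuation_ring_zmod.
HB.instance Definition _ := GRing.isMonoidMorphism.Build k valuation_ring
  const_valuation_ring const_valuation_ring_monoid.

Definition const_residue : {rmorphism k -> residue_field} :=
  residue \o const_valuation_ring.

Definition abhyankar : Prop :=
  exists r d n, [/\ rational_rank value_group r, trdeg const_residue d,
                    trdeg j n & (r + d = n)%N].

End Valuation.

Section ValuationIdeals.
Context (R : realType) (k : fieldType) (A : idomainType).
Context (j : {rmorphism k -> {fraction A}}) (nu : valuation R j).

Definition centered_on (m : set A) : Prop :=
  (forall a : A, tofrac a \in valuation_ring_pred nu) /\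
  m = [set a | (0%:E < value nu (tofrac a))%E].

Definition valuation_ideal (s : R) : set A :=
  [set a | (s%:E <= value nu (tofrac a))%E].

End ValuationIdeals.

(* A viewed as an A-module via the e-th iterate of Frobenius. *)
Definition Fpush (A : comNzRingType) (p : nat) (charAp : p \in [pchar A])
  (e : nat) : Type := A.

Section FrobeniusPushforward.
Context (A : comNzRingType) (p : nat) (charAp : p \in [pchar A]) (e : nat).

Local Notation FA := (Fpush charAp e).

HB.instance Definition _ := GRing.Zmodule.on FA.

Definition Fpush_scale (a : A) (x : FA) : FA := a ^+ (p ^ e) * (x : A).

Fact Fpush_scaleA a b x :
  Fpush_scale a (Fpush_scale b x) = Fpush_scale (a * b) x.
Proof. by rewrite /Fpush_scale exprMn -mulrA. Qed.

Fact Fpush_scale1 : left_id 1 Fpush_scale.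
Proof. by move=> x; rewrite /Fpush_scale expr1n mul1r. Qed.

Fact Fpush_scaleDr : right_distributive Fpush_scale +%R.
Proof. by move=> a x y; rewrite /Fpush_scale mulrDr. Qed.

Fact Fpush_scaleDl x : {morph Fpush_scale^~ x : a b / a + b}.
Proof.
move=> a b; rewrite /Fpush_scale exprDn_pchar ?mulrDl//.
by rewrite pnatX pnatE ?(pcharf_prime charAp)// charAp.
Qed.

HB.instance Definition _ := GRing.Zmodule_isLmodule.Build A FA
  Fpush_scaleA Fpush_scale1 Fpush_scaleDr Fpush_scaleDl.

End FrobeniusPushforward.

Section TestIdeals.
Context (R : realType) (A : comNzRingType) (p : nat).
Context (charAp : p \in [pchar A]).

Definition ceil_exp (a : set A) (t : R) (e : nat) : set A :=
  ideal_exp a `|Num.ceil (t * (p ^ e - 1)%:R)|%N.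

Definition test_stable (a : set A) (t : R) (J : set A) : Prop :=
  [/\ is_ideal J, J <> [set 0] &
      forall (e : nat) (phi : {linear Fpush charAp e -> A^o}), (0 < e)%N ->
        forall x : A, ideal_mul J (ceil_exp a t e) x -> J (phi x)].

(* The smallest member of [test_stable a t], which exists when A is an F-finite
   Noetherian domain, a <> 0 and t > 0. *)
Definition test_ideal (a : set A) (t : R) : set A :=
  smallest (test_stable a t) set0.

Definition asymptotic_test_ideal (a : R -> set A) (m : R) : set A :=
  ideal_gen (\bigcup_(l in [set l | (0 < l)%N])
    test_ideal (a (l%:R * m)) (l%:R^-1)).

End TestIdeals.

(* Main.v *)
Require Import Defs.
From HB Require Import structures.
From mathcomp Require Import all_boot all_order all_algebra.
From mathcomp Require Import all_classical all_reals.
From mathcomp Require Import -(notations) mpoly.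
From mathcomp Require Import ring lra zify.

(** Every [phi] in [Hom(F^e_* A, A)] satisfies [nu (phi x) >= nu x / p^e - C]
    with [C] independent of [e] and [phi]. Granting this, the valuation ideal
    [a_(s - 2C)] is stable under all the maps defining [tau(a_(ls)^(1/l))], so it
    contains [tau_s], and any [r] with [nu r >= 2C] works.

    The bound holds because [K] is defectless over [K^p]: there is a basis
    [w_1, .., w_m] of [K] over [K^p] with
    [nu (sum c_i^p w_i) = min nu (c_i^p w_i)]. Iterating such expansions gives one
    over [K^(p^e)] whose denominators divide the [p^e]-th power of a fixed element,
    which is what makes [C] uniform.

    Defectlessness: lift a rational basis of the value group and a transcendence
    basis of the residue field to [T] in [K] and put [L = k(T)]. Then [K / L] is
    finite by the Abhyankar equality, and the monomials in [T] with exponents [< p]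
    are a basis of [L / L^p] with the above property, because [nu] is a Gauss
    valuation on [k[T]]. Comparing the towers [K / L / L^p] and [K / K^p / L^p],
    whose pieces [K / L] and [K^p / L^p] are isomorphic by Frobenius, transports
    both the degree and the number of independent leading forms from [L / L^p] to
    [K / K^p]. *)

Set Implicit Arguments.
Unset Strict Implicit.
Unset Printing Implicit Defensive.

Import Order.TTheory GRing.Theory Num.Theory.

Local Open Scope classical_set_scope.
Local Open Scope ring_scope.

(** * Calculus of extended values *)

Section Value.
Context (R : realType) (k K : fieldType) (j : {rmorphism k -> K}).
Context (nu : valuation R j).
Local Notation v := (value nu).

Lemma value0 : v 0 = +oo%E.
Proof. by rewrite /value eqxx. Qed.

Lemma valueE x : x != 0 -> v x = (valuation_fun nu x)%:E.
Proof. by rewrite /value => /negbTE ->. Qed.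

(** Turns nonvanishing into a comparison of values, so that it can be passed along inequalities. *)
Lemma value_lt0 x : (v x < v 0)%E = (x != 0).
Proof. by rewrite value0 /value; case: eqVneq => //= _; rewrite ltry. Qed.

Lemma le_value0 x : (v x <= v 0)%E.
Proof. by rewrite value0 leey. Qed.

Lemma le_value_mul2l u x y : u != 0 -> (v (u * x) <= v (u * y))%E = (v x <= v y)%E.
Proof. by move=> u0; rewrite !valueM (valueE u0) leeD2lE. Qed.

Lemma lt_value_mul2l u x y : u != 0 -> (v (u * x) < v (u * y))%E = (v x < v y)%E.
Proof. by move=> u0; rewrite !ltNge le_value_mul2l. Qed.

Lemma le_value_wmul2l u x y : (v x <= v y)%E -> (v (u * x) <= v (u * y))%E.
Proof.
by have [->|u0] := eqVneq u 0; [rewrite !mul0r|rewrite le_value_mul2l].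
Qed.

Lemma le_value_wmul2r u x y : (v x <= v y)%E -> (v (x * u) <= v (y * u))%E.
Proof. by rewrite ![_ * u]mulrC; exact: le_value_wmul2l. Qed.

Lemma le_value_neq0 x y : (v x <= v y)%E -> y != 0 -> x != 0.
Proof. by rewrite -!value_lt0; exact: le_lt_trans. Qed.

Lemma le_valueD m x y : (m <= v x)%E -> (m <= v y)%E -> (m <= v (x + y))%E.
Proof. by move=> mx my; apply: le_trans (valueD _ _ _); rewrite le_min mx. Qed.

Lemma lt_valueD m x y : (m < v x)%E -> (m < v y)%E -> (m < v (x + y))%E.
Proof. by move=> mx my; apply: lt_le_trans (valueD _ _ _); rewrite lt_min mx. Qed.

Lemma le_valueB m x y : (m <= v x)%E -> (m <= v y)%E -> (m <= v (x - y))%E.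
Proof. by move=> mx my; apply: le_valueD; rewrite ?valueN. Qed.

Lemma lt_valueB m x y : (m < v x)%E -> (m < v y)%E -> (m < v (x - y))%E.
Proof. by move=> mx my; apply: lt_valueD; rewrite ?valueN. Qed.

Lemma le_value_sum m (I : Type) (s : seq I) (P : pred I) (f : I -> K) :
  (forall i, P i -> (m <= v (f i))%E) -> (m <= v (\sum_(i <- s | P i) f i))%E.
Proof.
by move=> mf; elim/big_rec: _ => [|i x Pi mx];
  [rewrite value0 leey|exact: le_valueD (mf _ Pi) mx].
Qed.

Lemma lt_value_sum x (I : Type) (s : seq I) (P : pred I) (f : I -> K) : x != 0 ->
  (forall i, P i -> (v x < v (f i))%E) -> (v x < v (\sum_(i <- s | P i) f i))%E.
Proof.
move=> x0 mf; elim/big_rec: _ => [|i y Pi my]; first by rewrite value_lt0.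
exact: lt_valueD (mf _ Pi) my.
Qed.

Lemma value_addr x y : (v x < v y)%E -> v (x + y) = v x.
Proof.
move=> xy; apply/eqP; rewrite eq_le; apply/andP; split; last first.
  by apply: le_valueD => //; exact: ltW.
rewrite leNgt; apply/negP => h.
by have := lt_valueB h xy; rewrite addrK ltxx.
Qed.

Lemma value_exp x n : (x != 0) -> v (x ^+ n) = (valuation_fun nu x *+ n)%:E.
Proof.
move=> x0; elim: n => [|n IH]; first by rewrite expr0 valueE ?oner_neq0// valuation1.
by rewrite exprS valueM IH valueE// -EFinD mulrS.
Qed.

End Value.

(** * Subfields of K *)

Section Subfield.
Context (K : fieldType).
Implicit Types F E : K -> Prop.

(** Subfields are predicates because [L], [K^p] and [L^p] are compared inside [K]. The convention
    [x / 0 = 0] makes the last clause harmless at [y = 0]. *)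
Definition is_subfield F : Prop :=
  [/\ F 1, forall x y, F x -> F y -> F (x - y) &
      forall x y, F x -> F y -> F (x / y)].

Context (F : K -> Prop) (hF : is_subfield F).

Lemma subfield1 : F 1. Proof. by case: hF. Qed.
Lemma subfieldB x y : F x -> F y -> F (x - y). Proof. by case: hF => _ + _; apply. Qed.
Lemma subfieldV_M x y : F x -> F y -> F (x / y). Proof. by case: hF => _ _; apply. Qed.
Lemma subfield0 : F 0. Proof. by rewrite -(subrr 1); apply: subfieldB; exact: subfield1. Qed.
Lemma subfieldN x : F x -> F (- x).
Proof. by move=> Fx; rewrite -sub0r; apply: subfieldB => //; exact: subfield0. Qed.
Lemma subfieldD x y : F x -> F y -> F (x + y).
Proof. by move=> Fx Fy; rewrite -[y]opprK; apply: subfieldB => //; exact: subfieldN. Qed.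
Lemma subfieldM x y : F x -> F y -> F (x * y).
Proof.
move=> Fx Fy; rewrite -[y]invrK; apply: subfieldV_M => //.
by rewrite -div1r; apply: subfieldV_M => //; exact: subfield1.
Qed.
Lemma subfield_sum (I : Type) (s : seq I) (P : pred I) (f : I -> K) :
  (forall i, P i -> F (f i)) -> F (\sum_(i <- s | P i) f i).
Proof. by move=> Ff; elim/big_ind: _ => //; [exact: subfield0|exact: subfieldD]. Qed.
Lemma subfield_prod (I : Type) (s : seq I) (P : pred I) (f : I -> K) :
  (forall i, P i -> F (f i)) -> F (\prod_(i <- s | P i) f i).
Proof. by move=> Ff; elim/big_ind: _ => //; [exact: subfield1|exact: subfieldM]. Qed.

Lemma is_subfield_setT : is_subfield (fun _ : K => True). Proof. by []. Qed.

End Subfield.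

(** * Independence and span of leading forms *)

Section Graded.
Context (R : realType) (k K : fieldType) (j : {rmorphism k -> K}).
Context (nu : valuation R j).
Local Notation v := (value nu).
Implicit Types F E : K -> Prop.

(* [gindep F A w] says that the leading forms of the [w i], [i] in [A], are
   linearly independent over the graded field of [F], and [gspan F A w z] that
   the leading form of [z] lies in their span. For the trivial valuation these
   are linear independence and span. *)
Definition gindep F (I : finType) (A : pred I) (w : I -> K) : Prop :=
  (forall i, A i -> w i != 0) /\
  forall c : I -> K, (forall i, F (c i)) -> forall i, A i ->
    (v (\sum_(i' | A i') c i' * w i') <= v (c i * w i))%E.

Definition gspan F (I : finType) (A : pred I) (w : I -> K) (z : K) : Prop :=
  exists c : I -> K, [/\ forall i, F (c i),
    forall i, A i -> (v z <= v (c i * w i))%E &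
    z != 0 -> (v z < v (z - \sum_(i | A i) c i * w i))%E].

(** Steinitz exchange for leading forms, by induction on [#|B|]: one [w j0] is eliminated by means
    of one [u i0], and the remaining vectors keep their values. *)
Lemma gindep_card F (I J : finType) (A : pred I) (B : pred J)
    (u : I -> K) (w : J -> K) : is_subfield F ->
  gindep F A u -> (forall i, A i -> gspan F B w (u i)) -> (#|A| <= #|B|)%N.
Proof.
move=> hF; move: {-1}#|B| (erefl #|B|) => n; elim: n A B u => [|n IH] A B u Bn iu su.
  rewrite leqn0; apply/negPn/negP => A0.
  have /card_gt0P[i Ai] : (0 < #|A|)%N by rewrite lt0n.
  have [c [_ _ h]] := su _ Ai.
  have := h (iu.1 _ Ai); rewrite big_pred0 ?subr0 ?ltxx// => l.
  by have := card0_eq Bn l.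
have [j0 Bj0] : exists j0, B j0.
  have : (0 < #|B|)%N by rewrite Bn.
  by move=> /card_gt0P[j0]; exists j0.
have B'n : #|[pred l | B l & l != j0]| = n.
  by move: Bn; rewrite (cardD1x Bj0) => -[].
have [c hc] : exists c : I -> J -> K, forall i, A i -> [/\ forall l, F (c i l),
    forall l, B l -> (v (u i) <= v (c i l * w l))%E &
    (v (u i) < v (u i - \sum_(l | B l) c i l * w l))%E].
  have /choice[c hc] : forall i, exists c : J -> K, A i -> [/\ forall l, F (c l),
    forall l, B l -> (v (u i) <= v (c l * w l))%E &
    (v (u i) < v (u i - \sum_(l | B l) c l * w l))%E].
    move=> i; have [Ai|nAi] := boolP (A i); last by exists (fun=> 0).
    by have [c [c1 c2 c3]] := su _ Ai; exists c => _; split=> //; apply: c3 (iu.1 _ Ai).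
  by exists c.
have [[i0 [Ai0 ci0]]|hno] := pselect (exists i0, A i0 /\ (v (c i0 j0 * w j0) <= v (u i0))%E);
    last first.
  apply: leqW; apply: (IH A [pred l | B l & l != j0] u) => // i Ai.
  have [c1 c2 c3] := hc _ Ai; exists (c i); split=> // [l /andP[Bl _]|_]; first exact: c2.
  have -> : u i - \sum_(l | B l && (l != j0)) c i l * w l =
      (u i - \sum_(l | B l) c i l * w l) + c i j0 * w j0.
    by rewrite [in RHS](bigD1 j0)//=; ring.
  apply: lt_valueD => //.
  by rewrite ltNge; apply/negP => h; apply: hno; exists i.
have [f1 f2 f3] := hc _ Ai0.
have ui0 := iu.1 _ Ai0.
have /andP[c00 w0] : (c i0 j0 != 0) && (w j0 != 0).
  by have := le_value_neq0 ci0 ui0; rewrite mulf_eq0 negb_or.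
(* Pivot at [(i0, j0)]: subtracting [e i * u i0] cancels the coefficient of [w j0] in the expansion
   of [u i]. *)
pose e i := c i j0 / c i0 j0.
pose u' i := u i - e i * u i0.
have Fe i : A i -> F (e i).
  by move=> /hc[? _ _]; apply: subfieldV_M.
have eu i : A i -> (v (u i) <= v (e i * u i0))%E.
  move=> Ai; have [_ g2 _] := hc _ Ai; apply: le_trans (g2 _ Bj0) _.
  have -> : c i j0 * w j0 = e i * (c i0 j0 * w j0) by rewrite mulrA /e divfK.
  exact: le_value_wmul2l.
(* Independence of the [u i] forbids cancellation of leading forms, so the elimination preserves
   values. *)
have u'u i : A i -> i != i0 -> v (u' i) = v (u i).
  move=> Ai ii0; apply/eqP; rewrite eq_le; apply/andP; split; last first.
    by apply: le_valueB => //; exact: eu.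
  pose d l : K := if l == i then 1 else if l == i0 then - e i else 0.
  have Fd l : F (d l).
    rewrite /d; case: ifP => _; first exact: subfield1.
    by case: ifP => _; [apply: subfieldN => //; exact: Fe|exact: subfield0].
  have := iu.2 d Fd i Ai; rewrite (bigD1 i)//= (bigD1 i0)/=; last by rewrite Ai0 eq_sym.
  rewrite big1 => [|l /andP[/andP[_ /negbTE l1] /negbTE l2]]; last by rewrite /d l1 l2 mul0r.
  by rewrite /d eqxx eq_sym (negbTE ii0) eqxx !mul1r addr0 mulNr.
suff : (#|[pred i | A i & i != i0]| <= #|[pred l | B l & l != j0]|)%N.
  by rewrite B'n (cardD1x Ai0).
rewrite B'n; apply: (IH [pred i | A i & i != i0] [pred l | B l & l != j0] u') => //.
  split=> [i /andP[Ai ii0]|d Fd i /andP[Ai ii0]].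
    by apply: (@le_value_neq0 _ _ _ _ nu _ (u i)); rewrite ?u'u//; exact: iu.1.
  (* A combination of the [u' l] is one of the [u l] in which [u i0] has coefficient [- S]. *)
  pose S := \sum_(l | A l && (l != i0)) d l * e l.
  pose d' l : K := if l == i0 then - S else if A l then d l else 0.
  have Fd' l : F (d' l).
    rewrite /d'; case: ifP => _; last by case: ifP => _ //; exact: subfield0.
    apply: subfieldN => //; apply: subfield_sum => // m /andP[Am _].
    by apply: subfieldM => //; exact: Fe.
  have := iu.2 d' Fd' i Ai; rewrite (bigD1 i0)//= {1}/d' eqxx.
  rewrite (eq_bigr (fun l => d l * u l)); last first.
    by move=> l /andP[Al /negbTE l0]; rewrite /d' l0 Al.
  have -> : - S * u i0 + \sum_(l | A l && (l != i0)) d l * u l =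
      \sum_(l | A l && (l != i0)) d l * u' l.
    rewrite /S mulNr mulr_suml addrC -sumrB; apply: eq_bigr => l _.
    by rewrite /u'; ring.
  move=> h; apply: (le_trans h); rewrite /d' (negbTE ii0) Ai.
  by apply: le_value_wmul2l; rewrite u'u.
move=> i /andP[/= Ai ii0]; have [g1 g2 g3] := hc _ Ai.
exists (fun l => c i l - e i * c i0 l); split.
- by move=> l; apply: subfieldB => //; apply: subfieldM => //; exact: Fe.
- move=> l /andP[Bl _]; rewrite u'u// mulrBl -mulrA; apply: le_valueB; first exact: g2.
  by apply: le_trans (eu _ Ai) _; apply: le_value_wmul2l; exact: f2.
move=> _; rewrite u'u//.
have -> : u' i - \sum_(l | B l && (l != j0)) (c i l - e i * c i0 l) * w l =
    (u i - \sum_(l | B l) c i l * w l) - e i * (u i0 - \sum_(l | B l) c i0 l * w l).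
  rewrite /u' !(bigD1 j0 Bj0)/= (eq_bigr (fun l => c i l * w l - e i * (c i0 l * w l))).
    rewrite sumrB -mulr_sumr.
    have -> : c i j0 = e i * c i0 j0 by rewrite /e divfK.
    ring.
  by move=> l _; ring.
apply: lt_valueB => //; have [->|e0] := eqVneq (e i) 0.
  by rewrite mul0r value_lt0; exact: iu.1.
by apply: le_lt_trans (eu _ Ai) _; rewrite lt_value_mul2l.
Qed.

End Graded.

(** * Maximal families and multiplicativity in towers *)

Section Towers.
Context (R : realType) (k K : fieldType) (j : {rmorphism k -> K}).
Context (nu : valuation R j).
Local Notation v := (value nu).
Implicit Types F E : K -> Prop.

Lemma gspan0 F (I : finType) (A : pred I) (w : I -> K) : F 0 -> gspan nu F A w 0.
Proof.
move=> F0; exists (fun=> 0); split=> // [i _|]; first by rewrite mul0r.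
by rewrite eqxx.
Qed.

Lemma gspan_card_gt0 F (I : finType) (w : I -> K) :
  gspan nu F xpredT w 1 -> (0 < #|I|)%N.
Proof.
move=> [c [_ _ h]]; rewrite lt0n; apply/negP => /eqP I0.
have := h (oner_neq0 K); rewrite big_pred0 ?subr0 ?ltxx// => i.
by have := fintype0 i I0.
Qed.

Lemma gindep_enum F (I : finType) (w : I -> K) : gindep nu F xpredT w ->
  gindep nu F xpredT (w \o (@enum_val I xpredT)).
Proof.
move=> [w0 iw]; split=> [i _|c Fc i _]; first exact: w0.
have := iw (c \o enum_rank) (fun _ => Fc _) (enum_val i) isT.
rewrite /= enum_valK (reindex _ (onW_bij _ (@enum_val_bij I)))/=.
by under eq_bigr do rewrite enum_valK.
Qed.

(** If independence failed, the leading forms of [a * z] and of the combination [T] of the [w i]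
    would cancel; then [z] has the leading form of [- T / a], which is in the span. *)
Lemma gindep_option F (I : finType) (w : I -> K) z : is_subfield F ->
  gindep nu F xpredT w -> ~ gspan nu F xpredT w z ->
  gindep nu F xpredT (fun o => if o is Some i then w i else z).
Proof.
move=> hF iw nz; set w' := (X in gindep _ _ _ X).
split=> [[i _|_]|c Fc].
- exact: iw.1.
- by apply/negP => /eqP /= z0; apply: nz; rewrite z0; apply: gspan0; exact: subfield0.
pose a := c None; pose T := \sum_i c (Some i) * w i.
have hT i : (v T <= v (c (Some i) * w i))%E by apply: (iw.2 (c \o Some)) => // ?; exact: Fc.
have -> : \sum_o c o * w' o = a * z + T.
  rewrite (bigD1 None)//=; congr (_ + _).
  rewrite (reindex_omap Some id)/=; last by case.
  by apply: eq_big => [i|i _]//; rewrite eqxx.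
(* The bound by [v (a * z)] implies the one by [v T], and [hT] passes it to the terms of [T]. *)
suff h1 : (v (a * z + T) <= v (a * z))%E.
  case=> [i _|_] //=; apply: le_trans (hT i).
  by have := le_valueB (lexx _) h1; rewrite addrAC subrr add0r.
have [->|a0] := eqVneq a 0; first by rewrite mul0r le_value0.
rewrite leNgt; apply/negP => h; apply: nz.
have vT : v T = v (a * z).
  by rewrite -(valueN nu (a * z)) -(value_addr (x := - (a * z)) (y := a * z + T)) ?valueN// addKr.
exists (fun i => - (c (Some i) / a)); split=> [i|i _|z0].
- by apply: subfieldN => //; apply: subfieldV_M => //; exact: Fc.
- by rewrite -(le_value_mul2l nu _ _ a0) mulrA mulrN mulrCA divff// mulr1 mulNr valueN -vT.
rewrite -(lt_value_mul2l nu _ _ a0); apply: (lt_le_trans h).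
rewrite mulrBr mulr_sumr; under [X in v (_ - X)]eq_bigr do
  rewrite mulrA mulrN mulrCA divff// mulr1 mulNr.
by rewrite sumrN opprK.
Qed.

Lemma gindep_max_gspan F (I : finType) (w : I -> K) : is_subfield F ->
  gindep nu F xpredT w ->
  (forall m (w' : 'I_m -> K), gindep nu F xpredT w' -> (m <= #|I|)%N) ->
  forall z, gspan nu F xpredT w z.
Proof.
move=> hF iw wmax z; apply: contrapT => nz.
have := wmax _ _ (gindep_enum (gindep_option hF iw nz)).
by rewrite card_option ltnn.
Qed.

Lemma gindep_max F N : is_subfield F ->
  (forall m (w : 'I_m -> K), gindep nu F xpredT w -> (m <= N)%N) ->
  exists m (w : 'I_m -> K), gindep nu F xpredT w /\ forall z, gspan nu F xpredT w z.
Proof.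
move=> hF hN.
pose P m := `[< exists w : 'I_m -> K, gindep nu F xpredT w >].
have P0 : exists m, P m.
  exists 0%N; apply/asboolP; exists (fun=> 0); split=> [[]//|c _ []//].
have PN m : P m -> (m <= N)%N by move=> /asboolP[w]; exact: hN.
case: (ex_maxnP P0 PN) => m /asboolP[w iw] mmax.
exists m, w; split=> //; apply: gindep_max_gspan => // m' w' iw'.
by rewrite card_ord; apply: mmax; apply/asboolP; exists w'.
Qed.

(** Group the sum by [i]: the inner sums lie in [E], so independence over [E] isolates one of them
    and independence over [F] one of its terms. *)
Lemma gindep_mul E F (I J : finType) (u : I -> K) (w : J -> K) :
  is_subfield E -> (forall x, F x -> E x) -> (forall i, E (w i)) ->
  gindep nu E xpredT u -> gindep nu F xpredT w ->
  gindep nu F xpredT (fun ij : I * J => u ij.1 * w ij.2).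
Proof.
move=> hE FE Ew [u0 iu] [w0 iw]; split=> [ij _|c Fc [i l] _ /=].
  by rewrite mulf_neq0 ?u0 ?w0.
have -> : \sum_ij c ij * (u ij.1 * w ij.2) = \sum_i (\sum_l c (i, l) * w l) * u i.
  rewrite (eq_bigr (fun ij => c (ij.1, ij.2) * (u ij.1 * w ij.2))); last by case.
  rewrite -(pair_bigA _ (fun i l => c (i, l) * (u i * w l)))/=.
  by apply: eq_bigr => i' _; rewrite mulr_suml; apply: eq_bigr => l' _; ring.
apply: (@le_trans _ _ (v ((\sum_l c (i, l) * w l) * u i))).
  apply: (iu (fun i => \sum_l c (i, l) * w l)) => // i'.
  by apply: subfield_sum => // l' _; apply: subfieldM => //; exact: FE.
rewrite [u i * _]mulrC mulrA; apply: le_value_wmul2r.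
by apply: (iw (fun l => c (i, l))).
Qed.

(** Expand over [E], then each coefficient [e i] over [F]. The second errors stay above [v z]
    because every [e i * u i] has value at least [v z]. *)
Lemma gspan_mul E F (I J : finType) (u : I -> K) (w : J -> K) :
  (forall z, gspan nu E xpredT u z) -> (forall z, E z -> gspan nu F xpredT w z) ->
  forall z, gspan nu F xpredT (fun ij : I * J => u ij.1 * w ij.2) z.
Proof.
move=> su sw z; have [e [Ee e1 e2]] := su z.
have /choice[c hc] : forall i, exists c : J -> K, [/\ forall l, F (c l),
    forall l, (v (e i) <= v (c l * w l))%E &
    e i != 0 -> (v (e i) < v (e i - \sum_l c l * w l))%E].
  by move=> i; have [c [c1 c2 c3]] := sw _ (Ee i); exists c; split=> // l; exact: c2.
exists (fun ij => c ij.1 ij.2); split=> [[i l]|[i l] _ /=|z0].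
- by have [] := hc i.
- have [_ h _] := hc i; apply: le_trans (e1 i isT) _.
  by rewrite [u i * _]mulrC mulrA; apply: le_value_wmul2r.
have -> : z - \sum_ij c ij.1 ij.2 * (u ij.1 * w ij.2) =
    (z - \sum_i e i * u i) + \sum_i (e i - \sum_l c i l * w l) * u i.
  rewrite -(pair_bigA _ (fun i l => c i l * (u i * w l)))/=.
  rewrite -addrA; congr (_ + _); rewrite (eq_bigr _ (fun i _ => mulrBl _ _ _)).
  rewrite sumrB addKr; congr (- _).
  by apply: eq_bigr => i' _; rewrite mulr_suml; apply: eq_bigr => l' _; ring.
apply: lt_valueD; first exact: e2.
apply: lt_value_sum => // i _; have [_ _ h] := hc i.
have [u0|u0] := eqVneq (u i) 0; first by rewrite u0 mulr0 value_lt0.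
have [e0|e0] := eqVneq (e i) 0.
  rewrite {1}e0 sub0r big1 ?oppr0 ?mul0r ?value_lt0// => l _.
  have [_ h' _] := hc i; apply/eqP; move: (h' l); rewrite e0 leNgt value_lt0.
  by rewrite negbK.
by apply: le_lt_trans (e1 i isT) _; rewrite ![_ * u i]mulrC lt_value_mul2l// h.
Qed.

End Towers.

(** * Frobenius on leading forms *)

Section Frobenius.
Context (R : realType) (k K : fieldType) (j : {rmorphism k -> K}).
Context (p : nat) (charK : p \in [pchar K]).
Implicit Types F E L : K -> Prop.

Definition frob_image F (x : K) : Prop := exists2 y, F y & x = y ^+ p.

Lemma frobD (x y : K) : (x + y) ^+ p = x ^+ p + y ^+ p.
Proof. by rewrite exprDn_pchar// pnatE// (pcharf_prime charK). Qed.

Lemma frobB (x y : K) : (x - y) ^+ p = x ^+ p - y ^+ p.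
Proof. by apply: (addIr (y ^+ p)); rewrite -frobD !subrK. Qed.

Lemma frob_gt0 : (0 < p)%N. Proof. exact: prime_gt0 (pcharf_prime charK). Qed.

Lemma frob_sum (I : Type) (s : seq I) (P : pred I) (f : I -> K) :
  (\sum_(i <- s | P i) f i) ^+ p = \sum_(i <- s | P i) f i ^+ p.
Proof.
apply: (big_morph (fun x => x ^+ p)) => [x y|]; first exact: frobD.
by rewrite expr0n; case: p frob_gt0.
Qed.

Lemma is_subfield_frob F : is_subfield F -> is_subfield (frob_image F).
Proof.
move=> [F1 FB FV]; split=> [|_ _ [x Fx ->] [y Fy ->]|_ _ [x Fx ->] [y Fy ->]].
- by exists 1; rewrite ?expr1n.
- by exists (x - y); [exact: FB|rewrite frobB].
- by exists (x / y); [exact: FV|rewrite expr_div_n].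
Qed.

Context (nu : valuation R j).
Local Notation v := (value nu).

Lemma le_value_exp (x y : K) n : (0 < n)%N -> (v (x ^+ n) <= v (y ^+ n))%E = (v x <= v y)%E.
Proof.
move=> n0; have [->|y0] := eqVneq y 0; first by rewrite expr0n gtn_eqF// !le_value0.
have [->|x0] := eqVneq x 0.
  by rewrite expr0n gtn_eqF//= ![(_ <= _)%E]leNgt !value_lt0 expf_neq0// y0.
by rewrite !value_exp// !valueE// !lee_fin ler_pMn2r.
Qed.

(** Frobenius is additive and multiplies values by [p], so it preserves every comparison of values;
    the same holds for spans below. *)
Lemma gindep_frob F (I : finType) (w : I -> K) : gindep nu F xpredT w ->
  gindep nu (frob_image F) xpredT (fun i => w i ^+ p).
Proof.
move=> [w0 iw]; split=> [i _|c' Fc' i _]; first by rewrite expf_neq0 ?w0.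
have /choice[c hc] : forall i, exists y, F y /\ c' i = y ^+ p.
  by move=> i'; have [y] := Fc' i'; exists y.
under eq_bigr do rewrite (hc _).2 -exprMn.
rewrite -frob_sum (hc _).2 -exprMn le_value_exp ?frob_gt0//.
by apply: iw => // i'; exact: (hc _).1.
Qed.

Lemma gspan_frob F (I : finType) (w : I -> K) z : gspan nu F xpredT w z ->
  gspan nu (frob_image F) xpredT (fun i => w i ^+ p) (z ^+ p).
Proof.
move=> [c [Fc c1 c2]]; exists (fun i => c i ^+ p); split=> [i|i _|z0].
- by exists (c i).
- by rewrite -exprMn le_value_exp ?frob_gt0// c1.
under eq_bigr do rewrite -exprMn.
rewrite -frob_sum -frobB ltNge le_value_exp ?frob_gt0// -ltNge c2//.
by apply: contraNneq z0 => ->; rewrite expr0n gtn_eqF ?frob_gt0.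
Qed.

(** * Counting in the towers K / L / L^p and K / K^p / L^p *)

Local Notation Kp := (frob_image (fun=> True)).

Context (L : K -> Prop) (hL : is_subfield L) (N : nat).
Hypothesis hN : forall m (w : 'I_m -> K), gindep nu L xpredT w -> (m <= N)%N.

(** With [w] a basis of leading forms over [L] and [u] a maximal family over [K^p], the products of
    [w] and [b] are independent over [L^p] while those of [u] and the [w i ^+ p] span. Hence
    [m * #|I| <= M * m], and [m] cancels. *)
Lemma frob_gindep_lower (I : finType) (b : I -> K) : (forall i, L (b i)) ->
  gindep nu (frob_image L) xpredT b ->
  exists m (u : 'I_m -> K), (#|I| <= m)%N /\ gindep nu Kp xpredT u.
Proof.
move=> Lb ib; apply: contrapT => hno.
have hLp x : frob_image L x -> L x.
  move=> [y Ly ->]; elim: {1}p => [|n IH]; first by rewrite expr0; exact: subfield1.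
  by rewrite exprS; apply: subfieldM.
have [m [w [iw sw]]] := gindep_max hL hN.
(* If no family reaches [#|I|] members, sizes are bounded and a maximal family exists. *)
have [M [u [iu su]]] : exists m (u : 'I_m -> K), gindep nu Kp xpredT u /\
    forall z, gspan nu Kp xpredT u z.
  apply: (@gindep_max _ _ _ _ nu Kp #|I|); first exact/is_subfield_frob/is_subfield_setT.
  move=> M u iu; rewrite leqNgt; apply/negP => h.
  by apply: hno; exists M, u; split=> //; exact: ltnW.
have swp z : Kp z -> gspan nu (frob_image L) xpredT (fun i => w i ^+ p) z.
  by move=> [y _ ->]; exact: gspan_frob.
have := gspan_mul su swp; have := gindep_mul hL hLp Lb iw ib.
move=> i1 s1; have := gindep_card (is_subfield_frob hL) i1 (fun i _ => s1 _).
rewrite !card_prod !card_ord => h.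
have m0 : (0 < m)%N by have := gspan_card_gt0 (sw 1); rewrite card_ord.
apply: hno; exists M, u; split=> //.
by rewrite -(leq_pmul2l m0) (leq_trans h)// mulnC.
Qed.

(** The reverse count: products of [u] with the [w i ^+ p] are independent and products of [w] with
    [b] span. For the trivial valuation this bounds the degree of [K] over [K^p]. *)
Lemma frob_gindep_upper (I : finType) (b : I -> K) : (forall i, L (b i)) ->
  (forall z, L z -> gspan nu (frob_image L) xpredT b z) ->
  forall m (u : 'I_m -> K), gindep nu Kp xpredT u -> (m <= #|I|)%N.
Proof.
move=> Lb sb M u iu.
have [m [w [iw sw]]] := gindep_max hL hN.
have s1 := gspan_mul sw sb.
have hLp x : frob_image L x -> Kp x by move=> [y _ ->]; exists y.
have Kw i : Kp (w i ^+ p) by exists (w i).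
have i1 := gindep_mul (is_subfield_frob (@is_subfield_setT K)) hLp Kw iu (gindep_frob iw).
have := gindep_card (is_subfield_frob hL) i1 (fun i _ => s1 _).
rewrite !card_prod !card_ord mulnC leq_pmul2l//.
by have := gspan_card_gt0 (sw 1); rewrite card_ord.
Qed.

End Frobenius.

(** * Polynomials presented as sums of monomials *)

Section SumMonomials.
Context (k : nzRingType) (S : comNzRingType) (f : {rmorphism k -> S}) (n : nat).
Context (h : 'I_n -> S) (I : Type) (s : seq I) (P : pred I).
Context (c : I -> k) (m : I -> multinom n).

Lemma mmap_sum_mnm : mmap f h (\sum_(i <- s | P i) c i *: mpolyX k (m i)) =
  \sum_(i <- s | P i) f (c i) * mmap1 h (m i).
Proof. by rewrite raddf_sum /=; apply: eq_bigr => i _; rewrite mmapZ mmapX. Qed.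

Lemma mcoeff_sum_mnm m0 : mcoeff m0 (\sum_(i <- s | P i) c i *: mpolyX k (m i)) =
  \sum_(i <- s | P i) c i * (m i == m0)%:R.
Proof. by rewrite raddf_sum; apply: eq_bigr => i _ /=; rewrite mcoeffZ mcoeffX. Qed.

End SumMonomials.

(** * The subfield k(T) *)

Section Rational.
Context (k K : fieldType) (j : {rmorphism k -> K}) (n : nat) (T : 'I_n -> K).

Definition ratfun (x : K) : Prop :=
  exists P Q : mpoly n k, mmap j T Q != 0 /\ x = mmap j T P / mmap j T Q.

Lemma ratfun_poly (P : mpoly n k) : ratfun (mmap j T P).
Proof. by exists P, 1; rewrite rmorph1 oner_neq0 divr1. Qed.

Lemma is_subfield_ratfun : is_subfield ratfun.
Proof.
split=> [|_ _ [P [Q [Q0 ->]]] [P' [Q' [Q'0 ->]]]|_ _ [P [Q [Q0 ->]]] [P' [Q' [Q'0 ->]]]].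
- by rewrite -(rmorph1 (mmap j T)); exact: ratfun_poly.
- exists (P * Q' - P' * Q), (Q * Q'); rewrite !rmorphM rmorphB !rmorphM mulf_neq0//.
  by split=> //; field; apply/andP.
- have [P'0|P'0] := eqVneq (mmap j T P') 0.
    rewrite P'0 mul0r invr0 mulr0 -(rmorph0 (mmap j T)); exact: ratfun_poly.
  exists (P * Q'), (Q * P'); rewrite !rmorphM mulf_neq0//.
  by split=> //; rewrite invf_div mulf_div.
Qed.

End Rational.

(** * Linear algebra as the case of the trivial valuation *)

Section Trivial.
Context (R : realType) (k K : fieldType) (j : {rmorphism k -> K}).

Definition trivial_valuation : valuation R j.
Proof.
by exists (fun=> 0) => [//|x y _ _|x y _ _ _]; rewrite ?addr0 ?minxx.
Defined.

Lemma le_value_trivial x y : x != 0 -> (value trivial_valuation x <= value trivial_valuation y)%E.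
Proof.
by move=> x0; rewrite /value (negbTE x0) /=; case: ifP => _; rewrite ?leey.
Qed.

Lemma gspan_trivial F (I : finType) (w : I -> K) (c : I -> K) : F 0 ->
  (forall i, F (c i)) -> gspan trivial_valuation F xpredT w (\sum_i c i * w i).
Proof.
move=> F0 Fc; have [->|s0] := eqVneq (\sum_i c i * w i) 0; first exact: gspan0.
exists c; split=> // [i _|_]; first exact: le_value_trivial.
by rewrite subrr value_lt0.
Qed.

Lemma gspan_trivialP F (I : finType) (w : I -> K) z :
  gspan trivial_valuation F xpredT w z ->
  exists2 c : I -> K, (forall i, F (c i)) & z = \sum_i c i * w i.
Proof.
have [-> [c [Fc c1 _]]|z0 [c [Fc _ /(_ z0) h]]] := eqVneq z 0; exists c => //.
  rewrite big1// => i _; apply/eqP; have := c1 i isT.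
  by rewrite leNgt value_lt0 negbK.
apply/eqP; rewrite -subr_eq0; apply/negPn/negP => h0.
by move: h; rewrite ltNge le_value_trivial.
Qed.

(** A vanishing combination has value [+oo], and independence of leading forms passes this to each
    of its terms. *)
Lemma gindep_trivial (nu : valuation R j) F (I : finType) (w : I -> K) :
  gindep nu F xpredT w -> gindep trivial_valuation F xpredT w.
Proof.
move=> [w0 iw]; split=> // c Fc i _.
have [s0|] := eqVneq (\sum_i c i * w i) 0; last exact: le_value_trivial.
have := iw c Fc i isT; rewrite s0 leNgt value_lt0 negbK => /eqP ->.
exact: le_value0.
Qed.

End Trivial.

(** * Monomials with exponents below p, over the p-th powers of k(T) *)

Section Monomials.
Context (R : realType) (k K : fieldType) (j : {rmorphism k -> K}).
Context (p : nat) (charkp : p \in [pchar k]).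
Context (n : nat) (T : 'I_n -> K).
Let charK := rmorph_pchar j charkp.
Let L := ratfun j T.
Let p0 : (0 < p)%N := frob_gt0 charK.

Definition small_monomial (a : {ffun 'I_n -> 'I_p}) : K := \prod_i T i ^+ a i.

Lemma ratfun_small_monomial a : L (small_monomial a).
Proof.
have := ratfun_poly j T (mpolyX k (Multinom [tuple nat_of_ord (a i) | i < n])).
rewrite mmapX /mmap1; under eq_bigr do rewrite multinomE tnth_mktuple.
by [].
Qed.

(** The value of a sum is always at least the minimum over its terms; with this converse, [nu] is a
    monomial valuation on [k[T]]. *)
Definition gauss (nu : valuation R j) : Prop := forall (P : mpoly n k) m,
  (value nu (mmap j T P) <= value nu (j (mcoeff m P) * mmap1 T m))%E.

Definition frob_mnm (m : multinom n) (a : {ffun 'I_n -> 'I_p}) : multinom n :=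
  Multinom [tuple (m i * p + a i)%N | i < n].

Lemma frob_mnmE m a i : frob_mnm m a i = (m i * p + a i)%N.
Proof. by rewrite multinomE tnth_mktuple. Qed.

Lemma frob_mnm_inj m a m' a' : frob_mnm m a = frob_mnm m' a' -> m = m' /\ a = a'.
Proof.
move=> h; have hi i : (m i * p + a i = m' i * p + a' i)%N by rewrite -!frob_mnmE h.
split.
  apply/mnmP => i; have := congr1 (divn^~ p) (hi i).
  by rewrite /= !divnMDl// !divn_small// !addn0.
apply/ffunP => i; apply: val_inj; have := congr1 (modn^~ p) (hi i).
by rewrite /= !modnMDl !modn_small.
Qed.

Lemma mmap1_frob_mnm m a : mmap1 T (frob_mnm m a) = mmap1 T m ^+ p * small_monomial a.
Proof.
rewrite /mmap1 /small_monomial -prodrXl -big_split; apply: eq_bigr => i _ /=.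
by rewrite frob_mnmE exprD exprM.
Qed.

(** After clearing denominators the combination is a polynomial [G]. Division with remainder by [p]
    makes the exponents [frob_mnm m a] pairwise distinct, so no terms of [G] merge and [gauss]
    bounds its value by each of them. *)
Lemma gindep_small_monomial (nu : valuation R j) : (forall i, T i != 0) -> gauss nu ->
  gindep nu (frob_image p L) xpredT small_monomial.
Proof.
move=> T0 hG; split=> [a _|c Lc a0 _].
  by apply/prodf_neq0 => i _; rewrite expf_neq0.
have /choice[PQ hPQ] : forall a, exists PQ : mpoly n k * mpoly n k,
    mmap j T PQ.2 != 0 /\ c a = (mmap j T PQ.1 / mmap j T PQ.2) ^+ p.
  by move=> a; have [_ [P [Q [Q0 ->]]] ->] := Lc a; exists (P, Q).
(* A common denominator of the p-th roots of the [c a]. *)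
pose Q := \prod_a mmap j T (PQ a).2.
pose P' a := (PQ a).1 * \prod_(a' | a' != a) (PQ a').2.
have Q0 : Q != 0 by apply/prodf_neq0 => a _; exact: (hPQ a).1.
have cE a : Q ^+ p * c a = mmap j T (P' a) ^+ p.
  rewrite (hPQ a).2 -exprMn; congr (_ ^+ p); rewrite /Q (bigD1 a)//= rmorphM rmorph_prod.
  by rewrite mulrAC mulrCA divff ?(hPQ a).1// mulr1.
rewrite -(@le_value_mul2l _ _ _ _ _ (Q ^+ p)) ?expf_neq0// mulrA cE mulr_sumr.
under eq_bigr do rewrite mulrA cE.
pose G := \sum_a \sum_(m <- msupp (P' a))
  (mcoeff m (P' a) ^+ p) *: mpolyX k (frob_mnm m a).
have PE a : mmap j T (P' a) ^+ p * small_monomial a = \sum_(m <- msupp (P' a))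
    j (mcoeff m (P' a) ^+ p) * mmap1 T (frob_mnm m a).
  rewrite /mmap (frob_sum charK) mulr_suml; apply: eq_bigr => m _.
  by rewrite mmap1_frob_mnm rmorphXn exprMn mulrA.
have -> : \sum_a mmap j T (P' a) ^+ p * small_monomial a = mmap j T G.
  rewrite /G raddf_sum; apply: eq_bigr => a _ /=.
  by rewrite PE mmap_sum_mnm.
rewrite PE big_seq; apply: le_value_sum => m0 m0P.
apply: le_trans (hG G (frob_mnm m0 a0)) _.
suff -> : mcoeff (frob_mnm m0 a0) G = mcoeff m0 (P' a0) ^+ p by [].
rewrite /G raddf_sum (bigD1 a0)//= [X in _ + X]big1 => [|a aa0]; last first.
  rewrite mcoeff_sum_mnm big1// => m _.
  by case: eqP => [/frob_mnm_inj[_ /eqP]|]; rewrite ?(negbTE aa0)// mulr0.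
rewrite addr0 mcoeff_sum_mnm (bigD1_seq m0)//= big1 => [|m mm0].
  by rewrite eqxx mulr1 addr0.
by case: eqP => [/frob_mnm_inj[/eqP + _]|]; rewrite ?(negbTE mm0)// mulr0.
Qed.

(** Perfectness makes the coefficients of a polynomial p-th powers; sorting its terms by exponents
    modulo [p] then gives p-th powers times small monomials. *)
Lemma gspan_small_monomial z : perfect_field charkp -> L z ->
  gspan (trivial_valuation R j) (frob_image p L) xpredT small_monomial z.
Proof.
move=> hperf [P [Q [Q0 ->]]].
(* The fraction becomes [S / Q ^+ p], whose denominator is a p-th power. *)
pose S := P * Q ^+ p.-1.
have /choice[y hy] : forall m, exists y, mcoeff m S = y ^+ p.
  by move=> m; have [y <-] := hperf (mcoeff m S); exists y; rewrite pFrobenius_autE.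
pose md (m : multinom n) : {ffun 'I_n -> 'I_p} := [ffun i => Ordinal (ltn_pmod (m i) p0)].
pose dv (m : multinom n) : multinom n := Multinom [tuple (m i %/ p)%N | i < n].
have mE m : m = frob_mnm (dv m) (md m).
  by apply/mnmP => i; rewrite frob_mnmE multinomE tnth_mktuple ffunE /= -divn_eq.
pose C a := \sum_(m <- msupp S | md m == a) y m *: mpolyX k (dv m).
have SE : mmap j T S = \sum_a mmap j T (C a) ^+ p * small_monomial a.
  rewrite {1}/mmap (partition_big md xpredT)//=; apply: eq_bigr => a _.
  rewrite /C mmap_sum_mnm (frob_sum charK) mulr_suml; apply: eq_bigr => m /eqP ma.
  by rewrite exprMn -mulrA -ma -mmap1_frob_mnm -mE hy rmorphXn.
have -> : mmap j T P / mmap j T Q =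
    \sum_a (mmap j T (C a) / mmap j T Q) ^+ p * small_monomial a.
  rewrite [RHS](eq_bigr (fun a => mmap j T (C a) ^+ p * small_monomial a / mmap j T Q ^+ p)).
    apply: (mulIf (expf_neq0 p Q0)); rewrite -mulr_suml divfK ?expf_neq0//.
    rewrite -SE rmorphM rmorphXn /=; have -> : mmap j T Q ^+ p = mmap j T Q * mmap j T Q ^+ p.-1.
      by rewrite -exprS prednK.
    by rewrite mulrA divfK.
  by move=> a _; rewrite expr_div_n mulrAC.
apply: gspan_trivial => [|a].
  exact: (subfield0 (is_subfield_frob charK (is_subfield_ratfun j T))).
exists (mmap j T (C a) / mmap j T Q) => //; by exists (C a), Q.
Qed.

End Monomials.

(** * Lifts from value group and residue field form a Gauss family *)

Section Gauss.
Context (R : realType) (k K : fieldType) (j : {rmorphism k -> K}).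
Context (nu : valuation R j).
Local Notation vf := (valuation_fun nu).

Lemma residue_neq0 x : residue nu x != 0 -> val x != 0 /\ vf (val x) = 0.
Proof.
move=> x0.
have rm : x \notin @valuation_max_ideal _ _ _ _ nu.
  apply: contra x0 => xm; rewrite -(rmorph0 (residue nu)).
  by rewrite /residue /= -Quotient.idealrBE subr0.
have v0 : val x != 0.
  apply: contra rm => /eqP r0.
  by rewrite -topredE /= /valuation_max_ideal r0 /value eqxx ltry.
split=> //; have := valP x; move: rm.
rewrite -!topredE /= /valuation_max_ideal /valuation_ring_pred /value.
rewrite (negbTE v0) lte_fin lee_fin -leNgt => h1 h2.
by apply/eqP; rewrite eq_le h1 h2.
Qed.

Lemma vf_prod (I : finType) (x : I -> K) (m : I -> nat) : (forall i, x i != 0) ->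
  vf (\prod_i x i ^+ m i) = \sum_i vf (x i) *+ m i.
Proof.
move=> x0.
suff [] : \prod_i x i ^+ m i != 0 /\ vf (\prod_i x i ^+ m i) = \sum_i vf (x i) *+ m i by [].
elim/big_rec2: _ => [|i s y _ [y0 <-]]; first by rewrite oner_neq0 valuation1.
have xi : x i ^+ m i != 0 by rewrite expf_neq0.
rewrite mulf_neq0// valuationM//; split=> //; congr (_ + _).
by have := value_exp nu (m i) (x0 i); rewrite valueE// => -[].
Qed.

Lemma seq_min (I : eqType) (s : seq I) (g : I -> R) i : i \in s ->
  exists2 i0, i0 \in s & forall i', i' \in s -> g i0 <= g i'.
Proof.
elim: s i => // a s IH _ _; case: s IH => [_|b s IH].
  by exists a; rewrite ?inE// => i' /[!inE] /eqP ->.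
have [i0 i0s h] := IH b (mem_head _ _).
have [l|l] := leP (g a) (g i0).
  exists a; rewrite ?mem_head// => i' /[1!inE] /predU1P[->//|/h]; exact: le_trans.
exists i0; first by rewrite in_cons i0s orbT.
move=> i' /[1!inE] /predU1P[->|/h//].
exact: ltW.
Qed.

Context (r d : nat) (z : 'I_r -> K) (t : 'I_d -> valuation_ring nu).
Hypothesis z0 : forall i, z i != 0.
Hypothesis zindep : forall c : 'I_r -> int,
  \sum_i vf (z i) *~ c i = 0 -> forall i, c i = 0.
Hypothesis tindep : alg_independent (const_residue nu) (residue nu \o t).

Definition join_fam (i : 'I_(r + d)) : K :=
  match fintype.split i with inl a => z a | inr b => val (t b) end.

Lemma residue_t_neq0 b : residue nu (t b) != 0.
Proof.
apply/negP => /eqP h.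
have := @tindep (mpolyX k (mnm1 b)); rewrite mmapX mmap1U /= h => /(_ erefl).
by move=> /(congr1 (mcoeff (mnm1 b))); rewrite mcoeffX eqxx mcoeff0 => /eqP; rewrite oner_eq0.
Qed.

Lemma join_fam_neq0 i : join_fam i != 0.
Proof.
rewrite /join_fam; case: fintype.split => [a|b]//.
exact: (residue_neq0 (residue_t_neq0 b)).1.
Qed.

Lemma join_faml a : join_fam (lshift d a) = z a.
Proof. by rewrite /join_fam (unsplitK (inl a)). Qed.

Lemma join_famr b : join_fam (rshift r b) = val (t b).
Proof. by rewrite /join_fam (unsplitK (inr b)). Qed.

(** The [t b] have value 0, so only the exponents at the [z a] contribute to the value of a
    monomial. *)
Let g (m : multinom (r + d)) : R := \sum_a vf (z a) *+ m (lshift d a).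

Lemma value_join_mnm c m : c != 0 -> value nu (j c * mmap1 join_fam m) = (g m)%:E.
Proof.
move=> c0; rewrite valueM valueE ?fmorph_eq0// valuation_const// add0e valueE; last first.
  by apply/prodf_neq0 => i _; rewrite expf_neq0 ?join_fam_neq0.
rewrite vf_prod ?join_fam_neq0//; last exact: join_fam_neq0.
rewrite big_split_ord/= [X in _ + X]big1 ?addr0.
  by congr (_%:E); apply: eq_bigr => a _; rewrite join_faml.
by move=> b _; rewrite join_famr (residue_neq0 (residue_t_neq0 b)).2 mul0rn.
Qed.

Lemma val_mmap1 (m : multinom d) : val (mmap1 t m) = \prod_b val (t b) ^+ m b.
Proof.
rewrite /mmap1; elim/big_rec2: _ => [//|b y x _ <-].
suff -> : val (t b) ^+ m b = val (t b ^+ m b) by [].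
by elim: (m b) => [//|n IH]; rewrite !exprS IH.
Qed.

(** By [zindep], all terms of minimal value share their exponents at the [z a]. Their sum is thus a
    monomial [zm] times a polynomial in [t], which is a unit by [tindep]; it has exactly the minimal
    value, and the other terms lie strictly above. *)
Lemma gauss_join : gauss join_fam nu.
Proof.
move=> P m; have [->|Pm] := eqVneq (mcoeff m P) 0.
  by rewrite rmorph0 mul0r le_value0.
have : m \in msupp P by rewrite mcoeff_msupp.
move=> mP; have [m0 m0P hm0] := seq_min g mP.
rewrite value_join_mnm//; apply: (@le_trans _ _ (g m0)%:E); last by rewrite lee_fin hm0.
pose beta (m : multinom (r + d)) : multinom d := Multinom [tuple m (rshift r b) | b < d].
pose Q := \sum_(m <- msupp P | g m == g m0) mcoeff m P *: mpolyX k (beta m).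
have geq m' : g m' = g m0 -> forall a, m' (lshift d a) = m0 (lshift d a).
  move=> e a; have := @zindep (fun a => (m' (lshift d a))%:Z - (m0 (lshift d a))%:Z).
  have -> : \sum_i vf (z i) *~ ((m' (lshift d i))%:Z - (m0 (lshift d i))%:Z) = 0.
    by under eq_bigr do rewrite mulrzBr -!pmulrn; rewrite sumrB -/(g m') -/(g m0) e subrr.
  by move=> /(_ erefl a) /eqP; rewrite subr_eq0 => /eqP[].
pose zm := \prod_a z a ^+ m0 (lshift d a).
have first_sum : \sum_(m <- msupp P | g m == g m0) j (mcoeff m P) * mmap1 join_fam m =
    zm * val (mmap (const_valuation_ring nu) t Q).
  rewrite /Q mmap_sum_mnm (raddf_sum val) mulr_sumr; apply: eq_bigr => m' /eqP e.
  transitivity (zm * (j (mcoeff m' P) * val (mmap1 t (beta m')))); last by [].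
  rewrite mulrCA; congr (_ * _).
  rewrite val_mmap1 [LHS]big_split_ord/=; congr (_ * _).
    by apply: eq_bigr => a _; rewrite join_faml (geq _ e).
  by apply: eq_bigr => b _; rewrite join_famr multinomE tnth_mktuple.
(* A term of minimal value is determined by its exponents at the [t b], so [beta] merges no
   coefficients. *)
have Q0 : Q != 0.
  apply/negP => /eqP Q0; move: (m0P); rewrite mcoeff_msupp => /negP; apply; apply/eqP.
  have := congr1 (mcoeff (beta m0)) Q0; rewrite mcoeff0 => <-.
  rewrite /Q mcoeff_sum_mnm big_mkcond (bigD1_seq m0)/=; last exact: msupp_uniq.
    rewrite !eqxx mulr1 big1 ?addr0// => m' m'm0.
    case: ifP => // /eqP e; case: eqP => [h|_]; last by rewrite mulr0.
    case/eqP: m'm0; apply/mnmP => i; case: (split_ordP i) => [a ->|b ->].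
      exact: geq.
    by have := congr1 (fun m : multinom d => m b) h; rewrite /beta !multinomE !tnth_mktuple.
  by [].
(* The residue is a nonzero polynomial evaluated at algebraically independent elements. *)
have U0 : residue nu (mmap (const_valuation_ring nu) t Q) != 0.
  suff -> : residue nu (mmap (const_valuation_ring nu) t Q) =
      mmap (const_residue nu) (residue nu \o t) Q.
    by apply/negP => /eqP /tindep; exact/eqP.
  rewrite /mmap rmorph_sum; apply: eq_bigr => m' _; rewrite rmorphM rmorph_prod; congr (_ * _).
  by apply: eq_bigr => b _; rewrite rmorphXn.
have [U1 U2] := residue_neq0 U0.
have zm0 : zm != 0 by apply/prodf_neq0 => a _; rewrite expf_neq0.
have v1 : value nu (zm * val (mmap (const_valuation_ring nu) t Q)) = (g m0)%:E.
  by rewrite valueM (valueE nu U1) U2 adde0 valueE// vf_prod.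
rewrite /mmap (bigID (fun m => g m == g m0))/= first_sum value_addr ?v1//.
rewrite -v1 big_seq_cond; apply: lt_value_sum => [|m' /andP[m'P gm']].
  by rewrite mulf_neq0.
rewrite v1 value_join_mnm -?mcoeff_msupp// lte_fin lt_neqAle eq_sym gm'.
exact: hm0.
Qed.

End Gauss.

(** * Independent elements in a group of given rational rank *)

Lemma rational_rank_free (G : zmodType) r : rational_rank G r ->
  exists g : 'I_r -> G, forall c : 'I_r -> int,
    \sum_l g l *~ c l = 0 -> forall l, c l = 0.
Proof.
move=> [V [i [hi dV]]].
have hs m : (m <= r)%N -> exists2 s : seq G, size s = m & free (map i s).
  elim: m => [|m IH] mr; first by exists [::]; rewrite ?nil_free.
  have [s sm fs] := IH (ltnW mr).
  have [[x xU]|hno] := pselect (exists x, i x \notin <<map i s>>%VS).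
    by exists (x :: s); rewrite /= ?sm// free_cons xU.
  (* If the image of [i] lies in the span, both the projection onto it and the identity extend [i].
     Uniqueness makes the span all of [V], although its dimension is at most [m < r]. *)
  exfalso; have [h [_ hu]] := hi V i.
  have e1 : projv <<map i s>>%VS =1 h.
    apply: hu => x; apply: projv_id; apply/negPn/negP => xU; apply: hno; by exists x.
  have e2 : idfun =1 h by exact: hu.
  have : (fullv <= <<map i s>>)%VS.
    by apply/subvP => x _; rewrite -[x]/(idfun x) e2 -e1 memv_proj.
  move=> /dimvS; rewrite dV leqNgt => /negP; apply.
  by apply: leq_ltn_trans (dim_span _) _; rewrite size_map sm.
have [s sr fs] := hs r (leqnn r).
exists (fun l => s`_l) => c hc l.
have sz : size (map i s) == r by rewrite size_map sr.
have /freeP := fs : free (Tuple sz); move=> /(_ (fun l => (c l)%:~R)) h.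
apply/eqP; rewrite -(intr_eq0 rat); apply/eqP; apply: h => //.
transitivity (i (\sum_(l < r) s`_l *~ c l)); last by rewrite hc raddf0.
rewrite raddf_sum; apply: eq_bigr => l' _ /=.
by rewrite (nth_map 0) ?sr// raddfMz scaler_int.
Qed.

(** * Finiteness of K over k(T) *)

Section Bounded.
Context (R : realType) (k K : fieldType) (j : {rmorphism k -> K}).
Context (n : nat) (T : 'I_n -> K).
Hypothesis Tindep : alg_independent j T.
Hypothesis Tmax : forall m (x : 'I_m -> K), alg_independent j x -> (m <= n)%N.
Local Notation L := (ratfun j T).
Let hL : is_subfield L := is_subfield_ratfun j T.

(** [T] together with [y] is too large to be independent. Sorting a relation by powers of [y] gives
    [q], which is nonzero since [T] is independent. *)
Lemma algebraic_over_ratfun (y : K) :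
  exists q : {poly K}, [/\ q != 0, forall i, L q`_i & root q y].
Proof.
pose T' (i : 'I_(n + 1)) := match fintype.split i with inl a => T a | inr _ => y end.
have [P [P0 Py]] : exists P : mpoly (n + 1) k, P != 0 /\ mmap j T' P = 0.
  apply: contrapT => h.
  suff /Tmax : alg_independent j T' by rewrite addn1 ltnn.
  by move=> P hP; apply/eqP/negPn/negP => P0; apply: h; exists P.
pose beta (m : multinom (n + 1)) : multinom n := Multinom [tuple m (lshift 1 a) | a < n].
pose e (m : multinom (n + 1)) : nat := m (rshift n ord0).
pose Q i := \sum_(m <- msupp P | e m == i) mcoeff m P *: mpolyX k (beta m).
pose q : {poly K} := \sum_(m <- msupp P) (j (mcoeff m P) * mmap1 T (beta m)) *: 'X^(e m).
have qE i : q`_i = mmap j T (Q i).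
  rewrite /q coef_sum /Q mmap_sum_mnm [RHS]big_mkcond; apply: eq_bigr => m _.
  by rewrite coefZ coefXn eq_sym; case: eqP; rewrite ?mulr1 ?mulr0.
exists q; split=> [|i|].
- have [m0 m0P] : exists m0, m0 \in msupp P.
    move: P0; rewrite -msupp_eq0; case: (msupp P) => // m0 ? _.
    by exists m0; rewrite mem_head.
  apply/negP => /eqP q0; have := qE (e m0); rewrite q0 coef0 => /esym /Tindep.
  move=> /(congr1 (mcoeff (beta m0))); rewrite mcoeff0 mcoeff_sum_mnm.
  rewrite big_mkcond (bigD1_seq m0)/=; [|by []|exact: msupp_uniq].
  rewrite !eqxx mulr1 big1 ?addr0 => [/eqP|m' m'm0]; first by rewrite mcoeff_eq0 m0P.
  case: ifP => // /eqP em; case: eqP => [h|_]; last by rewrite mulr0.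
  case/eqP: m'm0; apply/mnmP => i; case: (split_ordP i) => [a ->|b ->].
    by have := congr1 (fun m : multinom n => m a) h; rewrite /beta !multinomE !tnth_mktuple.
  by rewrite (ord1 b).
- by rewrite qE; exact: ratfun_poly.
apply/eqP; rewrite -[RHS]Py /q horner_sum; apply: eq_bigr => m _.
rewrite hornerZ hornerXn -mulrA; congr (_ * _).
rewrite /mmap1 big_split_ord big_ord1 /=; congr (_ * _); last first.
  by rewrite /T' (unsplitK (inr ord0)).
by apply: eq_bigr => a _; rewrite /T' (unsplitK (inl a)) multinomE tnth_mktuple.
Qed.

Definition power_span (y : K) (D : nat) (x : K) : Prop :=
  exists2 c : nat -> K, (forall a, L (c a)) & x = \sum_(a < D) c a * y ^+ a.

Lemma power_span_sum y D (I : finType) (P : pred I) (c : I -> K) (x : I -> K) :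
  (forall i, P i -> L (c i)) -> (forall i, P i -> power_span y D (x i)) ->
  power_span y D (\sum_(i | P i) c i * x i).
Proof.
move=> Lc Sx; elim/big_ind: _ => [|_ _ [c1 L1 ->] [c2 L2 ->]|i Pi].
- exists (fun=> 0) => [_|]; first exact: subfield0.
  by rewrite big1// => a _; rewrite mul0r.
- exists (fun a => c1 a + c2 a) => [a|]; first exact: subfieldD.
  by rewrite -big_split; apply: eq_bigr => a _; rewrite mulrDl.
have [c' L' ->] := Sx _ Pi; exists (fun a => c i * c' a) => [a|].
  by apply: subfieldM => //; exact: Lc.
by rewrite mulr_sumr; apply: eq_bigr => a _; rewrite mulrA.
Qed.

Lemma power_span_le y D D' x : (D <= D')%N -> power_span y D x -> power_span y D' x.
Proof.
move=> DD [c Lc ->]; exists (fun a => if (a < D)%N then c a else 0).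
  by move=> a; case: ifP => // _; exact: subfield0.
rewrite (big_ord_widen D' (fun a => c a * y ^+ a) DD) big_mkcond.
by apply: eq_bigr => a _; case: ifP; rewrite ?mul0r.
Qed.

(** [D] is the degree of an equation of [y] over [k(T)], which rewrites [y ^+ D] in lower powers;
    multiplying by [y] then never leaves the span. *)
Lemma power_span_all y : exists D, forall e, power_span y D (y ^+ e).
Proof.
have [q [q0 Lq qy]] := algebraic_over_ratfun y.
pose D := (size q).-1; exists D.
have szq : size q = D.+1 by rewrite prednK// lt0n size_poly_eq0.
have lt e : (e < D)%N -> power_span y D (y ^+ e).
  move=> eD; exists (fun a => if a == e then 1 else 0).
    by move=> a; case: ifP => _; [exact: subfield1|exact: subfield0].
  rewrite (bigD1 (Ordinal eD))//= eqxx mul1r big1 ?addr0// => a ae.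
  by rewrite ifN ?mul0r.
have yD : power_span y D (y ^+ D).
  have lq : q`_D != 0 by rewrite -[q`_D]/(lead_coef q) lead_coef_eq0.
  exists (fun a => - (q`_a / q`_D)).
    by move=> a; apply: subfieldN => //; apply: subfieldV_M.
  apply: (mulfI lq); move: qy; rewrite /root horner_coef szq big_ord_recr /=.
  rewrite addrC addr_eq0 => /eqP ->; rewrite mulr_sumr -sumrN; apply: eq_bigr => a _.
  by rewrite mulrA mulrN mulrCA divff// mulr1 mulNr.
elim=> [|e [c Lc IH]].
  (* If [D = 0], the claim for exponent 0 is [yD] itself. *)
  by have [D0|/lt//] := posnP D; move: yD; rewrite {2}D0.
rewrite exprSr IH mulr_suml; under eq_bigr do rewrite -mulrA -exprSr.
apply: power_span_sum => // a _.
have := ltn_ord a; rewrite leq_eqVlt => /predU1P[->//|]; exact: lt.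
Qed.

Lemma gindep_scale (nu : valuation R j) F (I : finType) (A : pred I) (w : I -> K) b : b != 0 ->
  gindep nu F A w -> gindep nu F A (fun i => b * w i).
Proof.
move=> b0 [w0 iw]; split=> [i Ai|c Fc i Ai]; first by rewrite mulf_neq0 ?w0.
under eq_bigr do rewrite mulrCA.
by rewrite -mulr_sumr mulrCA le_value_mul2l//; exact: iw.
Qed.

(** Monomials in [y] with exponents below [D'] span [k[y]] over [k(T)]. Scaling a family by a common
    denominator keeps it independent and moves it into [k[y]]. *)
Lemma gindep_ratfun_bounded (N : nat) (y : 'I_N -> K) : (forall x, ratfun j y x) ->
  exists M, forall m (w : 'I_m -> K),
    gindep (trivial_valuation R j) L xpredT w -> (m <= M)%N.
Proof.
move=> hy.
have /choice[D hD] : forall l, exists D, forall e, power_span (y l) D (y l ^+ e).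
  by move=> l; exact: power_span_all.
pose D' := \max_l D l.
have hD' l e : power_span (y l) D' (y l ^+ e).
  exact: power_span_le (leq_bigmax l) (hD l e).
pose Y (f : {ffun 'I_N -> 'I_D'}) := \prod_l y l ^+ f l.
have mono (m : multinom N) : exists2 C, (forall f, L (C f)) & mmap1 y m = \sum_f C f * Y f.
  have /choice[c hc] : forall l, exists c : nat -> K, (forall a, L (c a)) /\
      y l ^+ m l = \sum_(a < D') c a * y l ^+ a.
    by move=> l; have [c Lc e] := hD' l (m l); exists c.
  exists (fun f : {ffun 'I_N -> 'I_D'} => \prod_l c l (f l)) => [f|].
    by apply: subfield_prod => // l _; exact: (hc l).1.
  rewrite /mmap1 (eq_bigr _ (fun l _ => (hc l).2)) bigA_distr_bigA /=.
  by apply: eq_bigr => f _; rewrite big_split.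
have poly (P : mpoly N k) : exists2 C, (forall f, L (C f)) & mmap j y P = \sum_f C f * Y f.
  rewrite /mmap; elim/big_ind: _ => [|_ _ [C1 L1 ->] [C2 L2 ->]|m _].
  - exists (fun=> 0) => [_|]; first exact: subfield0.
    by rewrite big1// => a _; rewrite mul0r.
  - exists (fun f => C1 f + C2 f) => [f|]; first exact: subfieldD.
    by rewrite -big_split; apply: eq_bigr => a _; rewrite mulrDl.
  have [C LC ->] := mono m; exists (fun f => j (mcoeff m P) * C f) => [f|].
    apply: subfieldM => //; rewrite -(mmapC T j); exact: ratfun_poly.
  by rewrite mulr_sumr; apply: eq_bigr => f _; rewrite mulrA.
exists #|{ffun 'I_N -> 'I_D'}| => m w iw.
have /choice[PQ hPQ] : forall i, exists PQ : mpoly N k * mpoly N k,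
    mmap j y PQ.2 != 0 /\ w i = mmap j y PQ.1 / mmap j y PQ.2.
  by move=> i; have [P [Q [Q0 ->]]] := hy (w i); exists (P, Q).
pose Q := \prod_i mmap j y (PQ i).2.
have Q0 : Q != 0 by apply/prodf_neq0 => i _; exact: (hPQ i).1.
rewrite -[m]card_ord.
apply: (gindep_card (B := xpredT) (w := Y) hL (gindep_scale Q0 iw)) => i _.
have -> : Q * w i = mmap j y ((PQ i).1 * \prod_(i' | i' != i) (PQ i').2).
  rewrite (hPQ i).2 /Q (bigD1 i)//= rmorphM rmorph_prod mulrAC mulrCA.
  by rewrite divff ?(hPQ i).1// mulr1.
have [C LC ->] := poly ((PQ i).1 * \prod_(i' | i' != i) (PQ i').2).
by apply: gspan_trivial => //; exact: subfield0.
Qed.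

End Bounded.

(** * Defectlessness of K over K^p *)

Section Norming.
Context (R : realType) (k K : fieldType) (j : {rmorphism k -> K}).
Context (nu : valuation R j) (p : nat) (charkp : p \in [pchar k]).
Local Notation vf := (valuation_fun nu).
Let charK := rmorph_pchar j charkp.

(** By the Abhyankar equality, the number [r + d] of lifted elements is the transcendence degree of
    [K] over [k], hence the first clause. *)
Lemma abhyankar_gauss : abhyankar nu -> exists n (T : 'I_n -> K),
  [/\ forall m (x : 'I_m -> K), alg_independent j x -> (m <= n)%N,
      forall i, T i != 0 & gauss T nu].
Proof.
move=> [r [d [n [hr [[x hx] _] [_ hn] rdn]]]]; subst n; exists (r + d)%N.
have [g hg] := rational_rank_free hr.
have /choice[z hz] : forall l, exists x : K, x != 0 /\ vf x = val (g l).
  by move=> l; have /asboolP[y y0 yg] := valP (g l); exists y.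
have zindep (c : 'I_r -> int) : \sum_i vf (z i) *~ c i = 0 -> forall i, c i = 0.
  move=> hc; apply: hg; apply: val_inj; rewrite (raddf_sum val) -[RHS]hc.
  by apply: eq_bigr => i _; rewrite (hz i).2 (raddfMz val).
pose t b : valuation_ring nu := repr (x b).
have tE : residue nu \o t = x by apply/funext => b; rewrite /t /residue /= reprK.
have tindep : alg_independent (const_residue nu) (residue nu \o t) by rewrite tE.
have z0 i := (hz i).1.
exists (join_fam z t); split=> //.
- by move=> i; exact: join_fam_neq0.
- exact: gauss_join.
Qed.

(** A relation has value [+oo], which [gauss] forces on each of its terms. *)
Lemma gauss_alg_independent n (T : 'I_n -> K) : (forall i, T i != 0) ->
  gauss T nu -> alg_independent j T.
Proof.
move=> T0 hG P hP; apply/mpolyP => m; rewrite mcoeff0; apply/eqP.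
have := hG P m; rewrite hP leNgt value_lt0 negbK mulf_eq0 fmorph_eq0 => /orP[//|].
by apply: contraLR => _; apply/prodf_neq0 => i _; rewrite expf_neq0.
Qed.

(* K / K^p is defectless: it has a basis on which nu is computed coordinatewise. *)
Lemma abhyankar_norming_family N (y : 'I_N -> K) : perfect_field charkp ->
  (forall x, ratfun j y x) -> abhyankar nu ->
  exists m (w : 'I_m -> K), (forall i, w i != 0) /\ forall x, exists c : 'I_m -> K,
    x = \sum_i c i ^+ p * w i /\ forall i, (value nu x <= value nu (c i ^+ p * w i))%E.
Proof.
move=> hperf hy /abhyankar_gauss[n [T [hT T0 hG]]].
have hTi := gauss_alg_independent T0 hG.
have hL := is_subfield_ratfun j T.
have [M hM] := gindep_ratfun_bounded R hTi hT hy.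
have hM' m (w : 'I_m -> K) : gindep nu (ratfun j T) xpredT w -> (m <= M)%N.
  by move=> /gindep_trivial /hM.
have [m [u [hm iu]]] := frob_gindep_lower charK hL hM'
  (@ratfun_small_monomial k K j p n T) (gindep_small_monomial charkp T0 hG).
have upper := frob_gindep_upper charK hL hM
  (@ratfun_small_monomial k K j p n T) (fun z => gspan_small_monomial R hperf).
have hKp := is_subfield_frob charK (@is_subfield_setT K).
exists m, u; split=> [i|x]; first exact: iu.1.
(* [u] has at least as many members as there are small monomials, and [upper] allows no linearly
   independent family over [K^p] to be larger; so [u] spans. *)
have su : gspan (trivial_valuation R j) (frob_image p (fun=> True)) xpredT u x.
  apply: gindep_max_gspan => // [|m' w' iw']; first exact: gindep_trivial iu.
  by rewrite card_ord; apply: leq_trans hm; exact: upper iw'.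
have [c' Fc' xE] := gspan_trivialP su.
have /choice[c hc] : forall i, exists y, c' i = y ^+ p.
  by move=> i; have [e _ ->] := Fc' i; exists e.
exists c; split=> [|i]; first by rewrite xE; apply: eq_bigr => i _; rewrite hc.
by rewrite -hc xE; exact: iu.2.
Qed.

End Norming.

(** * Fractions, common denominators and generators of Frac A *)

Section Fraction.
Local Open Scope quotient_scope.

Lemma fraction_divE (A : idomainType) (x : {fraction A}) :
  exists a b : A, b != 0 /\ x = tofrac a / tofrac b.
Proof.
elim/quotW: x => x; exists (frac x).1, (frac x).2; split; first exact: denom_ratioP.
apply: (canRL (mulfK _)); first by rewrite tofrac_eq0 denom_ratioP.
unlock FracField.tofrac; rewrite -[LHS]FracField.pi_mul; apply/eqmodP.
rewrite /= FracField.equivfE /FracField.mulf !numden_Ratio ?mulf_neq0 ?oner_eq0 ?denom_ratioP//.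
by rewrite !mulr1 mulrC.
Qed.

Lemma common_denominator (A : idomainType) (I : finType) (x : I -> {fraction A}) :
  exists (b : A) (a : I -> A), b != 0 /\ forall i, tofrac b * x i = tofrac (a i).
Proof.
have /choice[ab hab] : forall i, exists ab : A * A, ab.2 != 0 /\ x i = tofrac ab.1 / tofrac ab.2.
  by move=> i; have [a [b [b0 e]]] := fraction_divE (x i); exists (a, b).
exists (\prod_i (ab i).2), (fun i => (ab i).1 * \prod_(i' | i' != i) (ab i').2).
split=> [|i]; first by apply/prodf_neq0 => i _; exact: (hab i).1.
rewrite (hab i).2 (bigD1 i)//= !rmorphM mulrAC mulrCA divff ?mulr1//.
by rewrite tofrac_eq0 (hab i).1.
Qed.

End Fraction.

(** The images of algebra generators of [B] generate: elements of [A], and then their fractions, are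
    quotients of polynomials in them. *)
Lemma eft_fraction_ratfun (k : fieldType) (A : idomainType) (iota : {rmorphism k -> A}) :
  essentially_of_finite_type iota ->
  exists N (y : 'I_N -> {fraction A}), forall x,
    ratfun (@tofrac A \o iota : {rmorphism k -> {fraction A}}) y x.
Proof.
move=> [B [h [S [g [[N [b hb]] _ [gS gdiv _] gh]]]]].
exists N, (fun i => tofrac (g (b i))) => x.
set j := (X in ratfun X).
have poly c : exists P, tofrac (g c) = mmap j (fun i => tofrac (g (b i))) P.
  have [P <-] := hb c; exists P; rewrite /mmap !rmorph_sum; apply: eq_bigr => m _.
  rewrite !rmorphM gh /mmap1 !rmorph_prod; congr (_ * _).
  by apply: eq_bigr => i _; rewrite !rmorphXn.
have hA a : ratfun j (fun i => tofrac (g (b i))) (tofrac a).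
  have [c [s [/gS us ->]]] := gdiv a.
  have [P hP] := poly c; have [Q hQ] := poly s.
  exists P, Q; rewrite -hP -hQ tofrac_eq0; split.
    by apply: contraTneq us => ->; rewrite unitr0.
  by rewrite rmorphM rmorphV.
have [a [d [_ ->]]] := fraction_divE x.
apply: subfieldV_M => //; exact: is_subfield_ratfun.
Qed.

(** * A uniform bound for maps F^e_* A -> A *)

Section Bound.
Context (R : realType) (k : fieldType) (A : idomainType) (p : nat).
Local Notation K := {fraction A}.
Context (j : {rmorphism k -> K}) (nu : valuation R j).
Context (charA : p \in [pchar A]).
Local Notation vf := (valuation_fun nu).
Local Notation v := (value nu).
Let charK : p \in [pchar K] := rmorph_pchar (@tofrac A) charA.
Let p_gt1 : (1 < p)%N := prime_gt1 (pcharf_prime charA).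

Lemma frobX_sum (e : nat) (I : Type) (s : seq I) (P : pred I) (f : I -> K) :
  (\sum_(i <- s | P i) f i) ^+ (p ^ e) = \sum_(i <- s | P i) f i ^+ (p ^ e).
Proof.
elim: e => [|e IH]; first by rewrite expn0 expr1; apply: eq_bigr => i _; rewrite expr1.
rewrite expnSr exprM IH (frob_sum charK).
by apply: eq_bigr => i _; rewrite -exprM.
Qed.

Context (m : nat) (w : 'I_m -> K) (w0 : forall i, w i != 0).
Hypothesis hw : forall x, exists c : 'I_m -> K,
  x = \sum_i c i ^+ p * w i /\ forall i, (v x <= v (c i ^+ p * w i))%E.
Context (delta : A) (delta0 : delta != 0) (B : R).
Hypothesis deltaw : forall i, exists a, tofrac delta * w i = tofrac a.
Hypothesis wB : forall i, vf (w i) <= B.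
Hypothesis B0 : 0 <= B.

(** A further round of expansion multiplies by some [w l ^+ (p ^ e)]; this keeps the accumulated
    exponent within [p^(e+1) - 1]. *)
Lemma expn_pred_le e : ((p ^ e).-1 + p ^ e <= (p ^ e.+1).-1)%N.
Proof.
have h : (0 < p ^ e)%N by rewrite expn_gt0 (ltnW p_gt1).
have : (p ^ e * 2 <= p ^ e.+1)%N by rewrite expnSr leq_pmul2l.
by lia.
Qed.

(* Expanding the coefficients of the expansion repeatedly; the denominators of
   the resulting family over K^(p^e) divide delta^(p^e - 1). *)
Lemma iterated_norming e (x : K) : exists (I : finType) (c W : I -> K),
  [/\ x = \sum_i c i ^+ (p ^ e) * W i,
      forall i, (v x <= v (c i ^+ (p ^ e) * W i))%E,
      forall i, W i != 0 /\ vf (W i) <= B *+ (p ^ e).-1 &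
      forall i, exists a, tofrac delta ^+ (p ^ e).-1 * W i = tofrac a].
Proof.
elim: e x => [|e IH] x.
  exists unit, (fun=> x), (fun=> 1); split=> [|_|_|_]; rewrite ?expn0 ?expr1 ?mulr1//.
  - by rewrite (bigD1 tt)//= big1 ?addr0 ?expr1 ?mulr1// => -[].
  - by rewrite oner_neq0 valuation1 mulr0n.
  - by exists 1; rewrite expr0 rmorph1.
have [I [c [W [xE vx hW dW]]]] := IH x.
have /choice[d hd] := fun i => hw (c i).
exists (I * 'I_m)%type, (fun il => d il.1 il.2), (fun il => w il.2 ^+ (p ^ e) * W il.1).
split=> [|[i l]|[i l]|[i l]] /=.
- rewrite xE -(pair_bigA _ (fun i l => d i l ^+ (p ^ e.+1) * (w l ^+ (p ^ e) * W i)))/=.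
  apply: eq_bigr => i _; rewrite {1}(hd i).1 frobX_sum mulr_suml; apply: eq_bigr => l _.
  by rewrite exprMn -exprM -expnS mulrA.
- apply: le_trans (vx i) _; rewrite mulrA expnS exprM -exprMn.
  by apply: le_value_wmul2r; rewrite le_value_exp ?expn_gt0 ?(ltnW p_gt1)// (hd i).2.
- have [W0 WB] := hW i; have wl : w l ^+ (p ^ e) != 0 by rewrite expf_neq0.
  split; first by rewrite mulf_neq0.
  rewrite valuationM//; have := value_exp nu (p ^ e) (w0 l); rewrite valueE// => -[->].
  apply: (@le_trans _ _ (B *+ ((p ^ e).-1 + p ^ e))).
    by rewrite mulrnDr addrC lerD// lerMn2r wB orbT.
  exact: ler_wpMn2l (expn_pred_le e).
- have [a ha] := dW i; have [b hb] := deltaw l.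
  exists (delta ^+ ((p ^ e.+1).-1 - ((p ^ e).-1 + p ^ e)) * b ^+ (p ^ e) * a).
  rewrite -{1}(subnKC (expn_pred_le e)) !rmorphM !rmorphXn /= -ha -hb !exprD exprMn.
  ring.
Qed.

Hypothesis vA : forall a : A, (0%:E <= v (tofrac a))%E.

(** Clear denominators in an expansion of [x] over [K^q]: [phi] then pulls out the [a i], whose
    values are controlled by that of [x] divided by [q]. The price is [B] for the [W i] and one
    [delta]. *)
Lemma frob_linear_bound e (phi : A -> A) (x : A) :
  (forall a b, phi (a + b) = phi a + phi b) ->
  (forall a b, phi (a ^+ (p ^ e) * b) = a * phi b) ->
  x != 0 ->
  ((vf (tofrac x) / (p ^ e)%:R - (B + vf (tofrac delta)))%:E <= v (tofrac (phi x)))%E.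
Proof.
move=> phiD phiM x0; set q := (p ^ e)%N.
have q0 : (0 < q)%N by rewrite expn_gt0 (ltnW p_gt1).
have qR : (0 < q%:R :> R) by rewrite ltr0n.
have [I [c [W [xE vx hW dW]]]] := iterated_norming e (tofrac x).
have /choice[u hu] := dW.
have [b [a [b0 hb]]] := common_denominator c.
have phi0 : phi 0 = 0 by apply: (addrI (phi 0)); rewrite -phiD !addr0.
have phi_sum (f : I -> A) : phi (\sum_i f i) = \sum_i phi (f i).
  exact: (big_morph phi phiD phi0).
have tX : tofrac x != 0 by rewrite tofrac_eq0.
have td : tofrac delta != 0 by rewrite tofrac_eq0.
have tb : tofrac b != 0 by rewrite tofrac_eq0.
(* [b ^+ q] clears the [c i ^+ q], [delta ^+ q.-1] clears [W i], and the remaining [delta] completes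
   a q-th power that [phi] can pull out on the left. *)
have key : (b * delta) ^+ q * x = \sum_i a i ^+ q * (u i * delta).
  apply/eqP; rewrite -tofrac_eq; apply/eqP.
  rewrite rmorphM rmorph_sum /= xE mulr_sumr; apply: eq_bigr => i _.
  rewrite !rmorphM !rmorphXn rmorphM /= -hu -hb -/q !exprMn.
  have -> : tofrac delta ^+ q = tofrac delta ^+ q.-1 * tofrac delta.
    by rewrite -exprSr prednK.
  ring.
have : tofrac b * tofrac delta * tofrac (phi x) = \sum_i tofrac (a i) * tofrac (phi (u i * delta)).
  rewrite -!rmorphM -phiM -/q key phi_sum rmorph_sum.
  by apply: eq_bigr => i _; rewrite phiM rmorphM.
move=> /(congr1 v) vE.
have [->|ph0] := eqVneq (tofrac (phi x)) 0; first by rewrite value0 leey.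
move: vE; rewrite !valueM (valueE nu tb) (valueE nu td) (valueE nu ph0) -!EFinD => vE.
suff : ((vf (tofrac b) + (vf (tofrac x) / q%:R - B))%:E <=
    v (\sum_i tofrac (a i) * tofrac (phi (u i * delta))))%E.
  by rewrite -vE !lee_fin; lra.
(* Values of [phi] lie in [A], so their valuation is nonnegative and only [a i] matters. *)
apply: le_value_sum => i _; rewrite valueM -[leLHS]adde0; apply: leeD => //.
rewrite -hb valueM (valueE nu tb) EFinD leeD2lE//.
have [c0|c0] := eqVneq (c i) 0; first by rewrite c0 value0 leey.
rewrite valueE// lee_fin lerBlDr ler_pdivrMr//.
have [W0 WB] := hW i.
have := vx i; rewrite valueM (valueE nu tX) (valueE nu W0) value_exp// -EFinD lee_fin -/q => h.
(* As [q.-1 <= q], the loss [B *+ q.-1] divided by [q] is at most [B], whatever [e] is. *)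
apply: (le_trans h); rewrite mulrDl !mulr_natr lerD2l; apply: (le_trans WB).
by apply: ler_wpMn2l => //; rewrite leq_pred.
Qed.

End Bound.

(** * Valuation ideals and elements of large value *)

Section ValuationIdeal.
Context (R : realType) (k : fieldType) (A : idomainType).
Context (j : {rmorphism k -> {fraction A}}) (nu : valuation R j).
Local Notation vf := (valuation_fun nu).
Local Notation v := (value nu).
Hypothesis vA : forall a : A, (0%:E <= v (tofrac a))%E.

Lemma is_ideal_valuation_ideal s : is_ideal (valuation_ideal nu s).
Proof.
split=> [|x y|a x]; rewrite /valuation_ideal /=.
- by rewrite rmorph0 value0 leey.
- by move=> hx hy; rewrite rmorphD /=; exact: le_valueD.
- by rewrite rmorphM valueM /= => h; rewrite -[leLHS]add0e; exact: leeD.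
Qed.

Lemma ideal_mul_valuation_ideal s t (I J : set A) :
  I `<=` valuation_ideal nu s -> J `<=` valuation_ideal nu t ->
  ideal_mul I J `<=` valuation_ideal nu (s + t).
Proof.
move=> hI hJ; apply: smallest_sub; first exact: is_ideal_valuation_ideal.
move=> _ [x Ix [y Jy <-]]; rewrite /valuation_ideal /= rmorphM valueM EFinD.
by apply: leeD; [exact: hI|exact: hJ].
Qed.

Lemma ideal_exp_valuation_ideal s n :
  ideal_exp (valuation_ideal nu s) n `<=` valuation_ideal nu (s *+ n).
Proof.
elim: n => [|n IH]; first by move=> x _; rewrite /valuation_ideal /= mulr0n.
by rewrite mulrS; exact: ideal_mul_valuation_ideal.
Qed.

(** A fraction of nonzero value has a numerator or denominator of positive value, whose powers have
    unbounded values because [R] is Archimedean. *)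
Lemma exists_large_value M : nontrivial_valuation nu ->
  exists2 x : A, x != 0 & M <= vf (tofrac x).
Proof.
move=> [x x0 vx]; have [a [b [b0 xE]]] := fraction_divE x.
have tb : tofrac b != 0 by rewrite tofrac_eq0.
have ta : tofrac a != 0 by apply: contra_neq x0 => a0; rewrite xE a0 mul0r.
have ge c : tofrac c != 0 -> 0 <= vf (tofrac c).
  by move=> c0; have := vA c; rewrite valueE.
have [c [c0 vc]] : exists c : A, tofrac c != 0 /\ 0 < vf (tofrac c).
  have [va|va] := ltP 0 (vf (tofrac a)); first by exists a.
  exists b; split=> //; rewrite lt_neqAle ge// andbT eq_sym; apply/eqP => vb.
  apply: vx; rewrite xE valuationM ?invr_eq0// valuationV// vb subr0.
  by apply/eqP; rewrite eq_le va ge.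
exists (c ^+ Num.bound (`|M| / vf (tofrac c))).
  by rewrite expf_neq0// -tofrac_eq0.
rewrite rmorphXn; have := value_exp nu (Num.bound (`|M| / vf (tofrac c))) c0.
rewrite valueE ?expf_neq0// => -[->]; rewrite -mulr_natl -ler_pdivrMr//.
apply: le_trans (ltW (archi_boundP _)); last by rewrite divr_ge0 ?normr_ge0 ?(ltW vc).
by rewrite ler_pM2r ?invr_gt0// ler_norm.
Qed.

End ValuationIdeal.

(** * Valuation ideals containing the asymptotic test ideals *)

Section TestIdeal.
Context (R : realType) (k : fieldType) (A : idomainType) (p : nat).
Context (j : {rmorphism k -> {fraction A}}) (nu : valuation R j).
Context (charA : p \in [pchar A]).
Local Notation vf := (valuation_fun nu).
Local Notation v := (value nu).
Hypothesis vA : forall a : A, (0%:E <= v (tofrac a))%E.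
Hypothesis nontriv : nontrivial_valuation nu.
Context (C : R).
Hypothesis C0 : 0 <= C.
Hypothesis hC : forall e (phi : {linear Fpush charA e -> A^o}) (x : A), x != 0 ->
  ((vf (tofrac x) / (p ^ e)%:R - C)%:E <= v (tofrac (phi x : A)))%E.

(* 2C absorbs the error: (s p^e - 2C) / p^e - C >= s - 2C because p^e >= 2. *)
Lemma test_stable_valuation_ideal (s : R) l : 0 <= s -> (0 < l)%N ->
  test_stable charA (valuation_ideal nu (l%:R * s)) (l%:R^-1 : R) (valuation_ideal nu (s - 2 * C)).
Proof.
move=> s0 l0; split; first exact: is_ideal_valuation_ideal.
  have [x x0 vx] := exists_large_value vA (s - 2 * C) nontriv.
  move=> h; have : valuation_ideal nu (s - 2 * C) x.
    by rewrite /valuation_ideal /= valueE ?tofrac_eq0// lee_fin.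
  by rewrite h => /eqP; rewrite (negbTE x0).
move=> e phi e0 x hx.
have [->|x0] := eqVneq x 0.
  by rewrite raddf0 /valuation_ideal /= rmorph0 value0 leey.
have q2 : (2 <= p ^ e)%N.
  rewrite -(prednK e0) expnS; apply: (@leq_trans (p * 1)).
    by rewrite muln1 prime_gt1// (pcharf_prime charA).
  by rewrite leq_pmul2l ?expn_gt0 ?prime_gt0// (pcharf_prime charA).
have qR : (2 <= (p ^ e)%:R :> R) by rewrite ler_nat.
apply: le_trans (hC phi x0); rewrite lee_fin.
(* Rounding up the exponent gives [l * N >= p^e - 1], so the [N]-th power of the ideal of level
   [l * s] has values at least [s * (p^e - 1)]. *)
have hs : ceil_exp p (valuation_ideal nu (l%:R * s)) (l%:R^-1 : R) e `<=`
    valuation_ideal nu (s * (p ^ e - 1)%:R).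
  move=> y /(ideal_exp_valuation_ideal vA); apply: le_trans; rewrite lee_fin.
  set N := `|_|%N.
  have hN : l%:R^-1 * (p ^ e - 1)%:R <= N%:R :> R.
    apply: le_trans (ceil_ge _) _; rewrite -[N%:R]/(N%:Z%:~R) ler_int /N.
    by rewrite abszE ler_norm.
  have -> : (l%:R * s) *+ N = s * (l%:R * N%:R) by rewrite -[LHS]mulr_natr; ring.
  rewrite ler_wpM2l//.
  have lR : 0 < l%:R :> R by rewrite ltr0n.
  by rewrite -(ler_pM2l lR) mulrA divff ?mul1r ?gt_eqF// in hN.
(* The levels add up to [(s - 2C) + s (p^e - 1) = s p^e - 2C]. *)
have := ideal_mul_valuation_ideal vA (fun y h => h) hs hx.
rewrite /valuation_ideal /= valueE ?tofrac_eq0// lee_fin natrB ?(ltnW q2)// => h.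
have qpos : 0 < (p ^ e)%:R :> R by apply: lt_le_trans qR.
rewrite lerBrDr ler_pdivlMr//; apply: le_trans h.
have := mulr_ge0 C0 (_ : 0 <= (p ^ e)%:R - 2 :> R); rewrite subr_ge0 qR => /(_ isT).
lra.
Qed.

(** The stable ideal does not depend on [l], so by minimality it contains every summand. *)
Lemma asymptotic_test_ideal_sub s : 0 <= s ->
  asymptotic_test_ideal charA (valuation_ideal nu) s `<=` valuation_ideal nu (s - 2 * C).
Proof.
move=> s0; apply: smallest_sub; first exact: is_ideal_valuation_ideal.
move=> x [l l0]; apply: smallest_sub => //; exact: test_stable_valuation_ideal.
Qed.

End TestIdeal.

(** * Choice of the constants and of the multiplier *)

Theorem theoremB (R : realType) (p : nat) (k : fieldType)
    (charkp : p \in [pchar k]) (hperf : perfect_field charkp)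
    (A : idomainType) (iota : {rmorphism k -> A}) (m : set A)
    (hreg : regular_local_ring m)
    (heft : essentially_of_finite_type iota)
    (nu : valuation R (@tofrac A \o iota : {rmorphism k -> {fraction A}}))
    (hnontriv : nontrivial_valuation nu)
    (habh : abhyankar nu)
    (hcent : centered_on nu m) :
  let tau := asymptotic_test_ideal (rmorph_pchar iota charkp)
               (valuation_ideal nu) in
  (exists2 r : A, r != 0 &
     forall s : R, 0 <= s ->
       forall x : A, tau s x -> valuation_ideal nu s (r * x)) /\
  \bigcap_(s in [set s : R | 0 <= s])
     ideal_colon (valuation_ideal nu s) (tau s) <> [set 0].
Proof.
move=> tau.
(* Such an [r] is a nonzero element of the intersection of the colon ideals. *)
suff [r r0 hr] : exists2 r : A, r != 0 &
     forall s : R, 0 <= s ->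
       forall x : A, tau s x -> valuation_ideal nu s (r * x).
  split; first by exists r.
  move=> h; have : [set 0] r by rewrite -h => s s0 x; exact: hr.
  by move=> /eqP; rewrite (negbTE r0).
have vA (a : A) : (0%:E <= value nu (tofrac a))%E by have := hcent.1 a.
have charA := rmorph_pchar iota charkp.
have [N [y hy]] := eft_fraction_ratfun heft.
have [n [w [w0 hw]]] := abhyankar_norming_family hperf hy habh.
have [delta [a [delta0 ha]]] := common_denominator w.
(* Absolute values make [B] nonnegative as well as an upper bound. *)
pose B : R := \sum_i `|valuation_fun nu (w i)|.
have B0 : 0 <= B by apply: sumr_ge0.
have wB i : valuation_fun nu (w i) <= B.
  by rewrite /B (bigD1 i)//= (le_trans (ler_norm _))// lerDl sumr_ge0.
pose C := B + valuation_fun nu (tofrac delta).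
have C0 : 0 <= C.
  by rewrite addr_ge0//; have := vA delta; rewrite valueE ?tofrac_eq0.
have hC e (phi : {linear Fpush (rmorph_pchar iota charkp) e -> A^o}) (x : A) : x != 0 ->
    ((valuation_fun nu (tofrac x) / (p ^ e)%:R - C)%:E <= value nu (tofrac (phi x : A)))%E.
  apply: (frob_linear_bound charA w0 hw delta0 (fun i => ex_intro _ (a i) (ha i)) wB B0 vA).
    by move=> b c; exact: (raddfD phi).
  by move=> b c; exact: (linearZ_LR phi b c).
have [r r0 vr] := exists_large_value vA (2 * C) hnontriv.
exists r => // s s0 x /(asymptotic_test_ideal_sub vA hnontriv C0 hC s0) hx.
rewrite /valuation_ideal /= rmorphM valueM valueE ?tofrac_eq0//.
have -> : s = 2 * C + (s - 2 * C) by ring.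
by rewrite EFinD; apply: leeD => //; rewrite lee_fin.
Qed.
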